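(* Let $E$ and $F$ be Banach lattices. For each of the following fourteen classes $\mathcal{P}\subseteq \mathrm{L}(E,F)$: $[\mathrm{PSP}](E,F)$, $[\mathrm{DPSP}](E,F)$, $[\mathrm{DDSP}](E,F)$, $[\mathrm{PGP}](E,F)$, $[\mathrm{DGP}](E,F)$, $[\mathrm{swl}](E,F)$, $[\mathrm{dswl}](E,F)$, $[\mathrm{sw}^*\mathrm{l}](E,F)$, $[\mathrm{d}](E,F)$, $[\text{bi-sP}](E,F)$, $[\mathrm{GPP}](E,F)$, $[\text{s-GPP}](E,F)$, $[\mathrm{BDP}](E,F)$, $[\text{s-BDP}](E,F)$, the space $\mathrm{r}\text{-}\mathcal{P}(E,F)$ of regularly $\mathcal{P}$-operators is a Banach space under its own enveloping norm $\|T\|_{\mathrm{r}\text{-}\mathcal{P}}=\inf\{\|S\| : \pm T\le S\in\mathcal{P}\}$.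
   Context: All vector spaces are real; operators are linear and bounded. $E,F$ are Banach lattices, $E',F'$ their norm duals, $E_+$, $F'_+$, etc. the positive cones, $\mathrm{L}(E,F)$ the space of all bounded operators, $\mathrm{L}_+(E,F)$ the set of positive ones, and $S\le T$ means $T-S\ge 0$. ''w-null'' means weakly convergent to $0$; ''w$^*$-null'' means weak$^*$ convergent to $0$ in a dual space. A sequence $(x_n)$ in a Banach lattice is disjoint if $|x_n|\wedge|x_m|=0$ for $n\neq m$. $T'$ is the adjoint of $T$. A bounded set $A$ in a Banach space $X$ is limited if every w$^*$-null sequence $(f_n)$ in $X'$ is uniformly null on $A$, i.e. $\sup_{a\in A}|f_n(a)|\to 0$. A bounded set $A$ in a Banach lattice $E$ is almost limited (a-limited) if every disjoint w$^*$-null sequence in $E'$ is uniformly null on $A$. An operator $T:E\to F$ is: - a $[\mathrm{PSP}]$-operator if $\|Tx_n\|\to0$ for each w-null $(x_n)$ in $E_+$; - a $[\mathrm{DPSP}]$-operator if $\|T'f_n\|\to 0$ for each w$^*$-null $(f_n)$ in $F'_+$; - a $[\mathrm{DDSP}]$-operator if $\|T'f_n\|\to 0$ for each disjoint w$^*$-null $(f_n)$ in $F'$; - a $[\mathrm{PGP}]$-operator if $(T'f_n)$ is w-null for each w$^*$-null $(f_n)$ in $F'_+$; - a $[\mathrm{DGP}]$-operator if $(T'f_n)$ is w-null for each disjoint w$^*$-null $(f_n)$ in $F'$; - an $[\mathrm{swl}]$-operator if $(|Tx_n|)$ is w-null for each w-null $(x_n)$ in $E$; - a $[\mathrm{dswl}]$-operator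 if $(|Tx_n|)$ is w-null for each disjoint w-null $(x_n)$ in $E$; - an $[\mathrm{sw}^*\mathrm{l}]$-operator if $(|T'f_n|)$ is w$^*$-null for each w$^*$-null $(f_n)$ in $F'$; - a $[\mathrm{d}]$-operator if $(|T'f_n|)$ is w$^*$-null for each disjoint w$^*$-null $(f_n)$ in $F'$; - a $[\text{bi-sP}]$-operator if $f_n(Tx_n)\to0$ for each w$^*$-null $(f_n)$ in $F'_+$ and each disjoint w-null $(x_n)$ in $E$; - a $[\mathrm{GPP}]$-operator if $T$ carries limited sets onto relatively compact sets; - an $[\text{s-GPP}]$-operator if $T$ carries almost limited subsets of $E$ onto relatively compact subsets of $F$; - a $[\mathrm{BDP}]$-operator if $T$ carries limited sets onto relatively weakly compact sets; - an $[\text{s-BDP}]$-operator if $T$ carries almost limited subsets of $E$ onto relatively weakly compact subsets of $F$. For each class, $[\,\cdot\,](E,F)$ denotes the set of all such operators in $\mathrm{L}(E,F)$. For $\mathcal{P}\subseteq\mathrm{L}(E,F)$, an operator $T:E\to F$ is a regularly $\mathcal{P}$-operator if $T=T_1-T_2$ with $T_1,T_2\in\mathcal{P}\cap\mathrm{L}_+(E,F)$; the set of these is $\mathrm{r}\text{-}\mathcal{P}(E,F)$. The notation $\pm T\le S$ means $T\le S$ and $-T\le S$. *)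

(* Defs.v *)
From HB Require Import structures.
From mathcomp Require Import all_boot all_order all_algebra.
From mathcomp Require Import all_classical all_reals all_analysis.
Set Implicit Arguments. Unset Strict Implicit. Unset Printing Implicit Defensive.
Import Order.TTheory GRing.Theory Num.Theory.
Import numFieldNormedType.Exports.
Local Open Scope classical_set_scope.
Local Open Scope ring_scope.

Section bounded_operators.
Context {R : realType} (E F : normedModType R).

Definition bounded_linear : {pred E -> F} :=
  fun f => `[< linear f /\ exists M : R, forall x, `|f x| <= M * `|x| >].

Lemma bounded_linear_submod_closed : submod_closed bounded_linear.
Proof.
split=> [|a f g].
  apply/asboolP; split; first by move=> a x y; rewrite /= scaler0 addr0.
  by exists 0 => x; rewrite normr0 mul0r.
move=> /asboolP[lf [M fM]] /asboolP[lg [N gN]]; apply/asboolP; split.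
  move=> b x y; rewrite !fctE lf lg !scalerDr !scalerA (mulrC a b).
  by rewrite addrACA.
exists (`|a| * M + N) => x; rewrite mulrDl -mulrA.
by rewrite (le_trans (ler_normD _ _))// lerD// normrZ ler_wpM2l.
Qed.

HB.instance Definition _ := GRing.isSubmodClosed.Build R (E -> F) bounded_linear
  bounded_linear_submod_closed.

Record bop := Bop { bop_fun :> E -> F ; _ : bop_fun \in bounded_linear }.

HB.instance Definition _ := [isSub for bop_fun].
HB.instance Definition _ := [Choice of bop by <:].
HB.instance Definition _ := [SubChoice_isSubLmodule of bop by <:].

Lemma bop_linear (T : bop) : linear T.
Proof. by case: T => f /= /asboolP[]. Qed.

HB.instance Definition _ (T : bop) :=
  GRing.isLinear.Build R E F _ T (bop_linear T).

Lemma bop_bounded (T : bop) : exists M : R, forall x, `|T x| <= M * `|x|.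
Proof. by case: T => f /= /asboolP[]. Qed.

Lemma bop_ext (S T : bop) : S =1 T -> S = T.
Proof. by move=> ST; apply/val_inj/funext. Qed.

Lemma bopDE (S T : bop) x : (S + T) x = S x + T x.
Proof. by []. Qed.

Lemma bopNE (T : bop) x : (- T) x = - T x.
Proof. by []. Qed.

Lemma bopZE a (T : bop) x : (a *: T) x = a *: T x.
Proof. by []. Qed.

Definition opnorm (T : bop) : R := sup [set `|T x| | x in [set x | `|x| <= 1]].

Lemma opnorm_has_sup (T : bop) :
  has_sup [set `|T x| | x in [set x | `|x| <= 1]].
Proof.
split; first by exists `|T 0|, 0 => //=; rewrite normr0.
have [M TM] := bop_bounded T; exists `|M| => _ [x /= x1 <-].
rewrite (le_trans (TM x))// (le_trans (ler_norm _))// normrM.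
by rewrite normr_id -[leRHS]mulr1 ler_wpM2l.
Qed.

Lemma opnorm_ge0 (T : bop) : 0 <= opnorm T.
Proof.
apply: (@le_trans _ _ `|T 0|) => //.
by apply: sup_upper_bound (opnorm_has_sup T) _ _; exists 0 => //=; rewrite normr0.
Qed.

Lemma opnormP (T : bop) x : `|T x| <= opnorm T * `|x|.
Proof.
have [->|x0] := eqVneq x 0; first by rewrite linear0 !normr0 mulr0.
have xp : 0 < `|x| by rewrite normr_gt0.
rewrite -ler_pdivrMr// mulrC.
have -> : `|x|^-1 * `|T x| = `|T (`|x|^-1 *: x)|.
  by rewrite linearZ/= normrZ gtr0_norm ?invr_gt0.
apply: sup_upper_bound (opnorm_has_sup T) _ _; exists (`|x|^-1 *: x) => //=.
by rewrite normrZ gtr0_norm ?invr_gt0// mulVf ?lt0r_neq0.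
Qed.

Lemma opnorm_le (T : bop) (M : R) :
  0 <= M -> (forall x, `|T x| <= M * `|x|) -> opnorm T <= M.
Proof.
move=> M0 TM; apply: ge_sup; first by case: (opnorm_has_sup T).
by move=> _ [x /= x1 <-]; rewrite (le_trans (TM x))// ler_piMr.
Qed.

Lemma opnormD (S T : bop) : opnorm (S + T) <= opnorm S + opnorm T.
Proof.
apply: opnorm_le => [|x]; first by rewrite addr_ge0 ?opnorm_ge0.
by rewrite bopDE mulrDl (le_trans (ler_normD _ _))// lerD ?opnormP.
Qed.

Lemma opnormZ (a : R) (T : bop) : opnorm (a *: T) = `|a| * opnorm T.
Proof.
have le b S : opnorm (b *: S) <= `|b| * opnorm S.
  apply: opnorm_le => [|x]; first by rewrite mulr_ge0 ?opnorm_ge0.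
  by rewrite bopZE normrZ -mulrA ler_wpM2l ?opnormP.
apply/eqP; rewrite eq_le le/=.
have [->|a0] := eqVneq a 0; first by rewrite normr0 mul0r opnorm_ge0.
rewrite -ler_pdivlMl ?normr_gt0// -normfV.
by rewrite -[in leLHS](scalerK a0 T) le.
Qed.

Lemma opnorm_eq0 (T : bop) : opnorm T = 0 -> T = 0.
Proof.
move=> T0; apply: bop_ext => x; apply/eqP; rewrite -normr_le0.
by rewrite (le_trans (opnormP T x))// T0 mul0r.
Qed.

HB.instance Definition _ :=
  Lmodule_isNormed.Build R bop opnormD opnormZ opnorm_eq0.

Lemma bop_normP (T : bop) x : `|T x| <= `|T| * `|x|.
Proof. exact: opnormP. Qed.

Lemma bop_norm_le (T : bop) (M : R) :
  0 <= M -> (forall x, `|T x| <= M * `|x|) -> `|T| <= M.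
Proof. exact: opnorm_le. Qed.

End bounded_operators.
Arguments bounded_linear {R E F}.

Section bounded_operators_complete.
Context {R : realType} (E : normedModType R) (F : completeNormedModType R).

Lemma bop_complete (G : set_system (bop E F)) :
  ProperFilter G -> cauchy G -> cvg G.
Proof.
move=> GG /cauchyP Gc.
have evG (e : R) T x : 0 < e -> G (ball T e) ->
    {near G, forall S : bop E F, `|T x - S x| <= e * `|x|}.
  move=> e0 GT; apply: filterS GT => S.
  rewrite -ball_normE /ball_ /= => /ltW TS.
  have -> : T x - S x = (T - S) x by [].
  by rewrite (le_trans (bop_normP _ _))// ler_wpM2r.
have Gx x : cvg ((fun T : bop E F => T x) @ G).
  apply: cauchy_cvg; apply: cauchy_exP => e e0.
  have x1 : 0 < `|x| + 1 by rewrite ltr_wpDl.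
  have e1 : 0 < e / (`|x| + 1) by rewrite divr_gt0.
  have [T GT] := Gc _ e1; exists (T x).
  apply: filterS (evG _ _ x e1 GT) => S.
  rewrite -ball_normE /ball_ /= => /le_lt_trans; apply.
  by rewrite -mulrA gtr_pMr// mulrC ltr_pdivrMr// mul1r ltrDl.
pose L x := lim ((fun T : bop E F => T x) @ G).
have LT (e : R) T x : 0 < e -> G (ball T e) -> `|T x - L x| <= e * `|x|.
  move=> e0 GT.
  have TL : (fun S : bop E F => `|T x - S x|) @ G --> `|T x - L x|.
    by apply: cvg_norm; apply: cvgB; [exact: cvg_cst|exact: Gx].
  exact: cvgr_to_le TL (evG _ _ x e0 GT).
have Llin : linear L.
  move=> a x y; rewrite /L; apply: cvg_lim => //.
  rewrite (_ : (fun T : bop E F => _) = (fun T : bop E F => a *: T x + T y)).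
    by apply: cvgD; [apply: cvgZr; exact: Gx|exact: Gx].
  by apply/funext => T; rewrite linearP.
have Lb : L \in bounded_linear.
  apply/asboolP; split => //; have [T GT] := Gc 1 ltr01.
  exists (`|T| + 1) => x; rewrite mulrDl.
  rewrite -[L x](subrK (T x)) addrC (le_trans (ler_normD _ _))// lerD ?bop_normP//.
  by rewrite distrC LT.
apply/cvg_ex; exists (Bop Lb); apply/cvgrPdist_le => e e0.
have e2 : 0 < e / 2 by rewrite divr_gt0.
have [T GT] := Gc _ e2; apply: filterS (GT) => S.
rewrite -ball_normE /ball_ /= => /ltW TS.
have -> : Bop Lb - S = (Bop Lb - T) + (T - S) by rewrite addrA subrK.
rewrite (le_trans (ler_normD _ _))// [leRHS]splitr lerD// distrC.
by apply: bop_norm_le => [|x]; [exact: ltW|exact: LT].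
Qed.

HB.instance Definition _ := Uniform_isComplete.Build (bop E F) bop_complete.

End bounded_operators_complete.

Definition dual {R : realType} (X : normedModType R) := bop X R.

HB.instance Definition _ (R : realType) (X : normedModType R) :=
  CompleteNormedModule.copy (dual X) (bop X R).

Reserved Notation "x <=o y" (at level 70, y at next level).

(* The lattice order is carried by the mixin itself: the hierarchy already joins
   order.v's structures with normed modules at numDomainType only, so a
   latticeType cannot be mixed with a completeNormedModType. *)
HB.mixin Record isBanachLattice (R : realType) E & CompleteNormedModule R E := {
  bl_le : E -> E -> Prop ;
  bl_join : E -> E -> E ;
  bl_meet : E -> E -> E ;
  bl_le_refl : forall x, bl_le x x ;
  bl_le_anti : forall x y, bl_le x y -> bl_le y x -> x = y ;
  bl_le_trans : forall y x z, bl_le x y -> bl_le y z -> bl_le x z ;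
  bl_joinP : forall x y z, bl_le (bl_join x y) z <-> bl_le x z /\ bl_le y z ;
  bl_meetP : forall x y z, bl_le z (bl_meet x y) <-> bl_le z x /\ bl_le z y ;
  bl_leD2r : forall z x y, bl_le x y -> bl_le (x + z) (y + z) ;
  bl_leZ : forall (a : R) x y, 0 <= a -> bl_le x y -> bl_le (a *: x) (a *: y) ;
  bl_le_norm : forall x y,
    bl_le (bl_join x (- x)) (bl_join y (- y)) -> `|x| <= `|y|
}.

#[short(type="banachLatticeType")]
HB.structure Definition BanachLattice (R : realType) :=
  { E of CompleteNormedModule R E & isBanachLattice R E }.

Notation "x <=o y" := (bl_le x y) : ring_scope.

Section banach_lattice_theory.
Context {R : realType} {E : banachLatticeType R}.
Implicit Types (x y z u v : E) (a : R).

Definition modulus x : E := bl_join x (- x).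

Lemma bl_le_joinl x y : x <=o bl_join x y.
Proof. by have [] := (bl_joinP x y (bl_join x y)).1 (bl_le_refl _). Qed.

Lemma bl_le_joinr x y : y <=o bl_join x y.
Proof. by have [] := (bl_joinP x y (bl_join x y)).1 (bl_le_refl _). Qed.

Lemma bl_join_le x y z : x <=o z -> y <=o z -> bl_join x y <=o z.
Proof. by move=> xz yz; apply/bl_joinP. Qed.

Lemma bl_le_meetl x y : bl_meet x y <=o x.
Proof. by have [] := (bl_meetP x y (bl_meet x y)).1 (bl_le_refl _). Qed.

Lemma bl_le_meetr x y : bl_meet x y <=o y.
Proof. by have [] := (bl_meetP x y (bl_meet x y)).1 (bl_le_refl _). Qed.

Lemma bl_le_meet x y z : z <=o x -> z <=o y -> z <=o bl_meet x y.
Proof. by move=> xz yz; apply/bl_meetP. Qed.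

Lemma bl_leD x y u v : x <=o y -> u <=o v -> x + u <=o y + v.
Proof.
move=> xy uv; apply: (bl_le_trans (y + u)); first exact: bl_leD2r.
by rewrite ![y + _]addrC; exact: bl_leD2r.
Qed.

Lemma bl_le_subr_addr x y z : (x <=o y - z) <-> (x + z <=o y).
Proof.
split=> [/(bl_leD2r z)|/(bl_leD2r (- z))]; first by rewrite subrK.
by rewrite addrK.
Qed.

Lemma bl_le_subl_addr x y z : (x - z <=o y) <-> (x <=o y + z).
Proof.
split=> [/(bl_leD2r z)|/(bl_leD2r (- z))]; first by rewrite subrK.
by rewrite addrK.
Qed.

Lemma bl_subr_ge0 x y : (0 <=o y - x) <-> (x <=o y).
Proof. by rewrite bl_le_subr_addr add0r. Qed.

Lemma bl_leN x y : x <=o y -> - y <=o - x.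
Proof. by move=> xy; rewrite -[- y]add0r bl_le_subl_addr addrC bl_subr_ge0. Qed.

Lemma bl_addr_ge0 x y : 0 <=o x -> 0 <=o y -> 0 <=o x + y.
Proof. by move=> x0 y0; rewrite -(addr0 0); exact: bl_leD. Qed.

Lemma bl_scaler_ge0 a x : 0 <= a -> 0 <=o x -> 0 <=o a *: x.
Proof. by move=> a0 x0; rewrite -(scaler0 _ a); exact: bl_leZ. Qed.

Lemma bl_joinD x y z : bl_join x y + z = bl_join (x + z) (y + z).
Proof.
apply: bl_le_anti.
  by rewrite -bl_le_subr_addr; apply: bl_join_le; rewrite bl_le_subr_addr;
    [exact: bl_le_joinl|exact: bl_le_joinr].
by apply: bl_join_le; apply: bl_leD2r; [exact: bl_le_joinl|exact: bl_le_joinr].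
Qed.

Lemma bl_joinZ a x y : 0 <= a -> a *: bl_join x y = bl_join (a *: x) (a *: y).
Proof.
have le b u v : 0 <= b -> bl_join (b *: u) (b *: v) <=o b *: bl_join u v.
  by move=> b0; apply: bl_join_le; apply: bl_leZ => //;
    [exact: bl_le_joinl|exact: bl_le_joinr].
rewrite le_eqVlt => /predU1P[<-|a0].
  rewrite !scale0r; apply: bl_le_anti; first exact: bl_le_joinl.
  by apply: bl_join_le; exact: bl_le_refl.
apply: bl_le_anti; last exact/le/ltW.
have aV : 0 <= a^-1 by rewrite invr_ge0 ltW.
have := le _ (a *: x) (a *: y) aV; rewrite !scalerA mulVf ?gt_eqF// !scale1r.
move=> /(bl_leZ _ _ _ (ltW a0)).
by rewrite scalerA mulfV ?gt_eqF// scale1r.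
Qed.

Definition ppos x : E := bl_join x 0.

Lemma ppos_ge0 x : 0 <=o ppos x.
Proof. exact: bl_le_joinr. Qed.

Lemma ppos_sub x : x = ppos x - ppos (- x).
Proof.
by apply/eqP; rewrite eq_sym subr_eq addrC /ppos bl_joinD addNr add0r;
  apply/eqP/bl_le_anti; apply: bl_join_le;
  first [exact: bl_le_joinl|exact: bl_le_joinr].
Qed.

Lemma modulusE x : modulus x = ppos x + ppos (- x).
Proof.
have /eqP := ppos_sub x; rewrite eq_sym subr_eq => /eqP ppx.
have -> : ppos (- x) = ppos x - x by rewrite ppx addrAC subrr add0r.
rewrite addrA -mulr2n -scaler_nat /ppos bl_joinZ// bl_joinD scaler0 add0r.
by rewrite scaler_nat mulr2n addrK.
Qed.

Lemma modulus_ge0 x : 0 <=o modulus x.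
Proof. by rewrite modulusE; apply: bl_addr_ge0; exact: ppos_ge0. Qed.

Lemma ge0_modulus x : 0 <=o x -> modulus x = x.
Proof.
move=> x0; apply: bl_le_anti; last exact: bl_le_joinl.
apply: bl_join_le; first exact: bl_le_refl.
by apply: (bl_le_trans 0) => //; rewrite -oppr0; exact: bl_leN.
Qed.

Lemma le_modulus x : x <=o modulus x.
Proof. exact: bl_le_joinl. Qed.

Lemma norm_modulus x : `|modulus x| = `|x|.
Proof.
apply/eqP; rewrite eq_le; apply/andP; split; apply: bl_le_norm;
  rewrite -!/(modulus _) (ge0_modulus (modulus_ge0 x)); exact: bl_le_refl.
Qed.

Lemma ge0_le_norm x y : 0 <=o x -> x <=o y -> `|x| <= `|y|.
Proof.
move=> x0 xy; apply: bl_le_norm; rewrite -/(modulus _) -/(modulus _).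
by rewrite !ge0_modulus//; exact: bl_le_trans xy.
Qed.

Lemma norm_ppos_le x : `|ppos x| <= `|x|.
Proof.
rewrite -(norm_modulus x); apply: ge0_le_norm (ppos_ge0 _) _.
by apply: bl_join_le; [exact: le_modulus|exact: modulus_ge0].
Qed.

Lemma riesz_decomposition x y z : 0 <=o x -> 0 <=o y -> 0 <=o z ->
  z <=o x + y -> exists u v, [/\ 0 <=o u, u <=o x, 0 <=o v, v <=o y & z = u + v].
Proof.
move=> x0 y0 z0 zxy; exists (bl_meet z x), (z - bl_meet z x); split.
- exact: bl_le_meet.
- exact: bl_le_meetr.
- by rewrite bl_subr_ge0; exact: bl_le_meetl.
- rewrite bl_le_subl_addr addrC -bl_le_subl_addr; apply: bl_le_meet.
    by rewrite bl_le_subl_addr -[X in X <=o _]addr0; apply: bl_leD => //; exact: bl_le_refl.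
  by rewrite bl_le_subl_addr.
- by rewrite addrC subrK.
Qed.

End banach_lattice_theory.

(* Riesz-Kantorovich: rk f x = sup {f y | 0 <= y <= x} is the value at x >= 0 of
   the positive part of f, and rkfun extends it linearly to E. *)
Section dual_banach_lattice.
Context {R : realType} (E : banachLatticeType R).
Implicit Types (x y z : E) (f g h : dual E).

Definition rkset f x := [set f y | y in [set y | 0 <=o y /\ y <=o x]].
Definition rk f x : R := sup (rkset f x).

Lemma rkset_sup f x : 0 <=o x -> has_sup (rkset f x).
Proof.
move=> x0; split; first by exists (f 0), 0 => //; split => //; exact: bl_le_refl.
exists (`|f| * `|x|) => _ [y [y0 yx] <-].
rewrite (le_trans (ler_norm _))// (le_trans (bop_normP f y))//.
by rewrite ler_wpM2l// ge0_le_norm.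
Qed.

Lemma rk_ub f x y : 0 <=o y -> y <=o x -> f y <= rk f x.
Proof.
move=> y0 yx; apply: sup_upper_bound; last by exists y.
by apply: rkset_sup; exact: bl_le_trans yx.
Qed.

Lemma rk_le f x (M : R) : 0 <=o x ->
  (forall y, 0 <=o y -> y <=o x -> f y <= M) -> rk f x <= M.
Proof.
move=> x0 fM; apply: ge_sup; first by case: (rkset_sup f x0).
by move=> _ [y [y0 yx] <-]; exact: fM.
Qed.

Lemma rk_ge0 f x : 0 <=o x -> 0 <= rk f x.
Proof.
by move=> x0; rewrite -(linear0 f); apply: rk_ub => //; exact: bl_le_refl.
Qed.

Lemma rkD f x y : 0 <=o x -> 0 <=o y -> rk f (x + y) = rk f x + rk f y.
Proof.
move=> x0 y0; have xy0 := bl_addr_ge0 x0 y0.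
apply/eqP; rewrite eq_le; apply/andP; split.
  apply: rk_le => // z z0 /(riesz_decomposition x0 y0 z0)[u [v [u0 ux v0 vy ->]]].
  by rewrite linearD lerD// rk_ub.
rewrite -lerBrDr; apply: rk_le => // u u0 ux.
rewrite lerBrDl -lerBrDr; apply: rk_le => // v v0 vy.
rewrite lerBrDr -linearD; apply: rk_ub; first exact: bl_addr_ge0.
by rewrite addrC; exact: bl_leD.
Qed.

Lemma rkZ f (a : R) x : 0 <= a -> 0 <=o x -> rk f (a *: x) = a * rk f x.
Proof.
have le (b : R) y : 0 < b -> 0 <=o y -> rk f (b *: y) <= b * rk f y.
  move=> b0 y0; apply: rk_le; first exact/bl_scaler_ge0/y0/ltW.
  move=> z z0 zy; rewrite -ler_pdivrMl// -[_ * _]/(b^-1 *: f z) -linearZ/=.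
  have bV : 0 <= b^-1 by rewrite invr_ge0 ltW.
  apply: rk_ub; first exact: bl_scaler_ge0.
  by rewrite -[y](scalerK (lt0r_neq0 b0)); exact: bl_leZ.
rewrite le_eqVlt => /predU1P[<-|a0] x0.
  rewrite scale0r mul0r; apply/eqP; rewrite eq_le rk_ge0 ?andbT//; last exact: bl_le_refl.
  apply: rk_le => [|y y0 yx]; first exact: bl_le_refl.
  by rewrite (bl_le_anti _ _ yx y0) linear0.
apply/eqP; rewrite eq_le le//=.
rewrite -ler_pdivlMl//.
rewrite -[X in rk f X <= _](scalerK (lt0r_neq0 a0)).
by apply: le; rewrite ?invr_gt0//; exact/bl_scaler_ge0/x0/ltW.
Qed.

Definition rkfun f x := rk f (ppos x) - rk f (ppos (- x)).

Lemma rkfunE f x u v : 0 <=o u -> 0 <=o v -> x = u - v -> rkfun f x = rk f u - rk f v.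
Proof.
move=> u0 v0 xuv; apply/eqP; rewrite /rkfun subr_eq addrAC eq_sym subr_eq.
rewrite -!rkD//; do ?exact: ppos_ge0.
apply/eqP; congr (rk f _); apply/eqP; rewrite -subr_eq -addrAC eq_sym.
by rewrite -subr_eq -xuv -ppos_sub.
Qed.

Lemma rkfun_linear f : linear (rkfun f : E -> R).
Proof.
move=> a x y; have [x0 xN0] := (ppos_ge0 x, ppos_ge0 (- x)).
have [y0 yN0] := (ppos_ge0 y, ppos_ge0 (- y)).
have [a0|/ltW aN0] := leP 0 a.
  rewrite (@rkfunE f (a *: x + y) (a *: ppos x + ppos y)
                          (a *: ppos (- x) + ppos (- y))).
  - rewrite !rkD ?rkZ//; do ?exact: bl_scaler_ge0.
    by rewrite /rkfun opprD addrACA -mulrBr.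
  - by apply: bl_addr_ge0 => //; exact: bl_scaler_ge0.
  - by apply: bl_addr_ge0 => //; exact: bl_scaler_ge0.
  - by rewrite opprD addrACA -scalerBr -!ppos_sub.
have a0 : 0 <= - a by rewrite oppr_ge0.
rewrite (@rkfunE f (a *: x + y) ((- a) *: ppos (- x) + ppos y)
                        ((- a) *: ppos x + ppos (- y))).
- rewrite !rkD ?rkZ//; do ?exact: bl_scaler_ge0.
  rewrite /rkfun opprD addrACA -mulrBr -[- a * _]mulrNN opprK opprB.
  by [].
- by apply: bl_addr_ge0 => //; exact: bl_scaler_ge0.
- by apply: bl_addr_ge0 => //; exact: bl_scaler_ge0.
- by rewrite opprD addrACA -scalerBr scaleNr -scalerN opprB -!ppos_sub.
Qed.

Lemma rkfun_bounded f : (rkfun f : E -> R) \in bounded_linear.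
Proof.
apply/asboolP; split; first exact: rkfun_linear.
have rkb x : 0 <=o x -> `|rk f x| <= `|f| * `|x|.
  move=> x0; rewrite ger0_norm ?rk_ge0//; apply: rk_le => // y y0 yx.
  rewrite (le_trans (ler_norm _))// (le_trans (bop_normP f y))//.
  by rewrite ler_wpM2l// ge0_le_norm.
exists (`|f| + `|f|) => x; rewrite (le_trans (ler_normB _ _))// mulrDl lerD//.
  by rewrite (le_trans (rkb _ (ppos_ge0 _)))// ler_wpM2l// norm_ppos_le.
rewrite (le_trans (rkb _ (ppos_ge0 _)))// ler_wpM2l//.
by rewrite -[leRHS]normrN norm_ppos_le.
Qed.

Definition fpos f : dual E := Bop (rkfun_bounded f).

Lemma fposE f x : 0 <=o x -> fpos f x = rk f x.
Proof.
move=> x0; rewrite /fpos/= (@rkfunE f x x 0) ?subr0//; last exact: bl_le_refl.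
have := rkZ f (lexx 0) x0; rewrite scale0r mul0r => ->.
by rewrite subr0.
Qed.

Definition dual_le f g : Prop := forall x, 0 <=o x -> f x <= g x.
Definition dual_join f g : dual E := g + fpos (f - g).
Definition dual_meet f g : dual E := f - fpos (f - g).

Lemma dual_le_refl f : dual_le f f. Proof. by []. Qed.

Lemma dual_le_anti f g : dual_le f g -> dual_le g f -> f = g.
Proof.
move=> fg gf; have fgE x : 0 <=o x -> f x = g x.
  by move=> x0; apply/eqP; rewrite eq_le fg ?gf.
apply: bop_ext => x; rewrite (ppos_sub x) !linearB/=.
by rewrite !fgE//; exact: ppos_ge0.
Qed.

Lemma dual_le_trans g f h : dual_le f g -> dual_le g h -> dual_le f h.
Proof. by move=> fg gh x x0; exact: le_trans (fg _ x0) (gh _ x0). Qed.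

Lemma fpos_le f h :
  dual_le (fpos f) h <-> dual_le f h /\ dual_le 0 h.
Proof.
split=> [fh|[fh h0] x x0].
  split=> x x0; apply: le_trans (fh x x0); rewrite fposE//.
    by apply: rk_ub => //; exact: bl_le_refl.
  exact: rk_ge0.
rewrite fposE//; apply: rk_le => // y y0 yx; rewrite (le_trans (fh _ y0))//.
rewrite -subr_ge0 -linearB; apply: (h0 (x - y)).
by rewrite bl_subr_ge0.
Qed.

Lemma dual_joinP f g h : dual_le (dual_join f g) h <-> dual_le f h /\ dual_le g h.
Proof.
have -> : dual_le (dual_join f g) h <-> dual_le (fpos (f - g)) (h - g).
  by split=> le x /le; rewrite /dual_join !bopDE bopNE lerBrDl.
rewrite fpos_le; split=> -[le1 le2]; split=> x x0.
- by have := le1 x x0; rewrite !bopDE bopNE lerD2r.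
- by have := le2 x x0; rewrite !bopDE bopNE subr_ge0.
- by have := le1 x x0; rewrite !bopDE bopNE lerD2r.
- by have := le2 x x0; rewrite !bopDE bopNE subr_ge0.
Qed.

Lemma dual_meetP f g h : dual_le h (dual_meet f g) <-> dual_le h f /\ dual_le h g.
Proof.
have -> : dual_le h (dual_meet f g) <-> dual_le (fpos (f - g)) (f - h).
  by split=> le x /le; rewrite /dual_meet !bopDE !bopNE lerBrDl -lerBrDr addrC // addrC.
rewrite fpos_le; split=> -[le1 le2]; split=> x x0.
- by have := le2 x x0; rewrite !bopDE bopNE subr_ge0.
- by have := le1 x x0; rewrite !bopDE !bopNE lerD2l lerN2.
- by have := le2 x x0; rewrite !bopDE !bopNE lerD2l lerN2.
- by have := le1 x x0; rewrite !bopDE bopNE subr_ge0.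
Qed.

Lemma dual_leD2r h f g : dual_le f g -> dual_le (f + h) (g + h).
Proof. by move=> fg x x0; rewrite !bopDE lerD2r fg. Qed.

Lemma dual_leZ (a : R) f g : 0 <= a -> dual_le f g -> dual_le (a *: f) (a *: g).
Proof. by move=> a0 fg x x0; rewrite !bopZE ler_wpM2l// fg. Qed.

Lemma dual_abs f x : `|f x| <= dual_join f (- f) (modulus x).
Proof.
have [fj Nfj] : dual_le f (dual_join f (- f)) /\ dual_le (- f) (dual_join f (- f)).
  exact/dual_joinP.
have [x0 xN0] := (ppos_ge0 x, ppos_ge0 (- x)).
rewrite modulusE linearD {1}(ppos_sub x) linearB (le_trans (ler_normB _ _))//.
by rewrite lerD// ler_norml lerNl fj ?andbT//; exact: Nfj.
Qed.

Lemma dual_join_norm f x : 0 <=o x -> dual_join f (- f) x <= `|f| * `|x|.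
Proof.
move=> x0; rewrite /dual_join bopDE bopNE opprK fposE// addrC lerBlDr.
apply: rk_le => // y y0 yx; rewrite bopDE -lerBlDr -linearD -linearB.
rewrite (le_trans (ler_norm _))// (le_trans (bop_normP f _))// ler_wpM2l//.
apply: bl_le_norm; rewrite -/(modulus x) ge0_modulus//; apply: bl_join_le.
  by rewrite bl_le_subl_addr; exact: bl_leD.
rewrite opprB bl_le_subl_addr -{1}[x]addr0; apply: bl_leD; first exact: bl_le_refl.
exact: bl_addr_ge0.
Qed.

Lemma dual_le_norm f g :
  dual_le (dual_join f (- f)) (dual_join g (- g)) -> `|f| <= `|g|.
Proof.
move=> fg; apply: bop_norm_le => // x; rewrite (le_trans (dual_abs f x))//.
rewrite (le_trans (fg _ (modulus_ge0 x)))//.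
by rewrite (le_trans (dual_join_norm _ (modulus_ge0 x)))// norm_modulus.
Qed.

HB.instance Definition _ := isBanachLattice.Build R (dual E)
  dual_le_refl dual_le_anti dual_le_trans dual_joinP dual_meetP
  dual_leD2r dual_leZ dual_le_norm.

End dual_banach_lattice.

Section duality.
Context {R : realType} {X : normedModType R}.

Definition w_null (x : nat -> X) : Prop :=
  forall f : dual X, f (x n) @[n --> \oo] --> (0 : R).

Definition wstar_null (f : nat -> dual X) : Prop :=
  forall x : X, f n x @[n --> \oo] --> (0 : R).

Definition norm_null (x : nat -> X) : Prop := `|x n| @[n --> \oo] --> (0 : R).

End duality.

(* The coarsest topology on X for which every f : dual X is continuous. *)
Definition weak {R : realType} (X : normedModType R) :=
  initial_topology ((fun x f => f x) : X -> {ptws (dual X) -> R}).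

HB.instance Definition _ (R : realType) (X : normedModType R) :=
  Topological.on (weak X).

Lemma cvg_initial (S : choiceType) (T : topologicalType) (f : S -> T)
    (F : set_system S) (s : S) : Filter F ->
  f @ F --> f s -> F --> (s : initial_topology f).
Proof.
move=> FF fs A; rewrite (@nbhsE (initial_topology f)) => -[B [[C oC <-] Cs] BA].
by apply: filterS BA _; apply: fs; exact: open_nbhs_nbhs.
Qed.

Lemma w_nullP (R : realType) (X : normedModType R) (x : nat -> X) :
  w_null x <-> (x : nat -> weak X) @ \oo --> (0 : weak X).
Proof.
split => [x0|x0 f].
  apply: cvg_initial; apply/cvg_sup => f; apply: cvg_initial.
  by have := x0 f; rewrite -(linear0 f).
pose ev (y : weak X) : {ptws (dual X) -> R} := fun f => f y.
have wf : continuous (@proj (dual X) (fun=> R) f \o ev : weak X -> R).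
  move=> y; apply: (@continuous_comp (weak X) {ptws (dual X) -> R} R).
    exact: initial_continuous.
  exact: (@proj_continuous (dual X) (fun=> R) f).
by rewrite -(linear0 f); exact: (cvg_comp _ _ x0 (wf 0)).
Qed.

Definition relatively_weakly_compact {R : realType} {X : normedModType R}
  (A : set X) : Prop := precompact (A : set (weak X)).

Lemma adjoint_bounded_linear {R : realType} {X Y : normedModType R}
    (T : bop X Y) (f : dual Y) : (f \o T : X -> R) \in bounded_linear.
Proof.
apply/asboolP; split => [a x y|]; first by rewrite /= !linearP.
exists (`|f| * `|T|) => x; rewrite -mulrA (le_trans (bop_normP f _))//.
by rewrite ler_wpM2l ?bop_normP.
Qed.

Definition adjoint {R : realType} {X Y : normedModType R}
  (T : bop X Y) (f : dual Y) : dual X := Bop (adjoint_bounded_linear T f).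

Section limited_sets.
Context {R : realType}.

Definition disjoint_seq {E : banachLatticeType R} (x : nat -> E) : Prop :=
  forall n m, n <> m -> bl_meet (modulus (x n)) (modulus (x m)) = 0.

(* For bounded A this is a genuine supremum, each f n being bounded on A. *)
Definition uniformly_null_on {X : normedModType R}
    (f : nat -> dual X) (A : set X) : Prop :=
  sup [set `|f n a| | a in A] @[n --> \oo] --> (0 : R).

Definition limited {X : normedModType R} (A : set X) : Prop :=
  bounded_set A /\
  forall f : nat -> dual X, wstar_null f -> uniformly_null_on f A.

Definition almost_limited {E : banachLatticeType R} (A : set E) : Prop :=
  bounded_set A /\
  forall f : nat -> dual E,
    disjoint_seq f -> wstar_null f -> uniformly_null_on f A.

End limited_sets.

Section operator_classes.
Context {R : realType} (E F : banachLatticeType R).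
Implicit Types (T : bop E F) (P : set (bop E F)).

Definition PSP : set (bop E F) := [set T : bop E F | forall x : nat -> E,
  (forall n, 0 <=o x n) -> w_null x -> norm_null (fun n => T (x n))].

Definition DPSP : set (bop E F) := [set T : bop E F | forall f : nat -> dual F,
  (forall n, 0 <=o f n) -> wstar_null f -> norm_null (fun n => adjoint T (f n))].

Definition DDSP : set (bop E F) := [set T : bop E F | forall f : nat -> dual F,
  disjoint_seq f -> wstar_null f -> norm_null (fun n => adjoint T (f n))].

Definition PGP : set (bop E F) := [set T : bop E F | forall f : nat -> dual F,
  (forall n, 0 <=o f n) -> wstar_null f -> w_null (fun n => adjoint T (f n))].

Definition DGP : set (bop E F) := [set T : bop E F | forall f : nat -> dual F,
  disjoint_seq f -> wstar_null f -> w_null (fun n => adjoint T (f n))].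

Definition swl : set (bop E F) := [set T : bop E F | forall x : nat -> E,
  w_null x -> w_null (fun n => modulus (T (x n)))].

Definition dswl : set (bop E F) := [set T : bop E F | forall x : nat -> E,
  disjoint_seq x -> w_null x -> w_null (fun n => modulus (T (x n)))].

Definition swstarl : set (bop E F) := [set T : bop E F | forall f : nat -> dual F,
  wstar_null f -> wstar_null (fun n => modulus (adjoint T (f n)))].

Definition d_op : set (bop E F) := [set T : bop E F | forall f : nat -> dual F,
  disjoint_seq f -> wstar_null f ->
  wstar_null (fun n => modulus (adjoint T (f n)))].

Definition bi_sP : set (bop E F) :=
  [set T : bop E F | forall (f : nat -> dual F) (x : nat -> E),
    (forall n, 0 <=o f n) -> wstar_null f -> disjoint_seq x -> w_null x ->
    f n (T (x n)) @[n --> \oo] --> (0 : R)].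

Definition GPP : set (bop E F) := [set T : bop E F | forall A : set E,
  limited A -> precompact (T @` A)].

Definition s_GPP : set (bop E F) := [set T : bop E F | forall A : set E,
  almost_limited A -> precompact (T @` A)].

Definition BDP : set (bop E F) := [set T : bop E F | forall A : set E,
  limited A -> relatively_weakly_compact (T @` A)].

Definition s_BDP : set (bop E F) := [set T : bop E F | forall A : set E,
  almost_limited A -> relatively_weakly_compact (T @` A)].

Definition positive_op T : Prop := forall x : E, 0 <=o x -> 0 <=o T x.

Definition op_le S T : Prop := positive_op (T - S).

Definition regularly P : set (bop E F) :=
  [set T : bop E F | exists T1 T2 : bop E F,
    [/\ P T1, positive_op T1, P T2, positive_op T2 & T = T1 - T2]].

(* For T in regularly P and P stable by addition the set below is nonempty:
   it contains the norm of T1 + T2 whenever T = T1 - T2 as above. *)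
Definition enveloping_norm P T : R :=
  inf [set `|S| | S in [set S : bop E F | [/\ op_le T S, op_le (- T) S & P S]]].

End operator_classes.
Arguments PSP {R} E F _.
Arguments DPSP {R} E F _.
Arguments DDSP {R} E F _.
Arguments PGP {R} E F _.
Arguments DGP {R} E F _.
Arguments swl {R} E F _.
Arguments dswl {R} E F _.
Arguments swstarl {R} E F _.
Arguments d_op {R} E F _.
Arguments bi_sP {R} E F _.
Arguments GPP {R} E F _.
Arguments s_GPP {R} E F _.
Arguments BDP {R} E F _.
Arguments s_BDP {R} E F _.

(* W is a linear subspace of V and (W, N) is a Banach space. *)
Definition banach_under {R : realType} {V : lmodType R}
    (W : set V) (N : V -> R) : Prop :=
  exists (B : completeNormedModType R) (i : {linear B -> V}),
    set_bij [set: B] W i /\ forall b : B, N (i b) = `|b|.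

(* Main.v *)
From HB Require Import structures.
Require Import Defs.
From mathcomp Require Import all_boot all_order all_algebra.
From mathcomp Require Import all_classical all_reals all_analysis.
From mathcomp Require Import ring lra.

(** Two independent facts give the theorem.

    First, let [P] be any linear subspace of the bounded operators that is closed
    for the operator norm. Then [T] is a regularly [P]-operator iff [T] is in [P]
    and is dominated by some [S] in [P], in the sense that [T <= S] and [- T <= S]
    ([regularlyP]). Domination is compatible with sums and scalars and gives
    [|T| <= |S|], so the enveloping norm is a norm that majorizes the operator
    norm. For completeness, take regularly [P]-operators [u n] of enveloping norm
    at most [2 ^- n] and dominate each one by some [S n] in [P] of comparable
    norm. Both series converge in operator norm because the space of bounded
    operators is complete, the sums stay in [P] because [P] is closed, and the
    tails of the second series dominate those of the first because the positive
    cone is closed ([regularly_series]). So the tails of the first series are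
    small for the enveloping norm ([regularly_banach]).

    Second, each of the fourteen classes is such a closed subspace. Ten of them
    ask that some sequences of seminorms of [T] tend to [0]. The sequences of
    vectors or functionals that occur are weakly or weak-star null, hence bounded
    by the Banach-Steinhaus theorem (with norming functionals in the weak case),
    so these seminorms are bounded by a common multiple of the operator norm, and
    convergence to [0] is stable under operator-norm limits
    ([closed_subspace_null]). The other four ask that [T] map certain bounded sets
    [A] to relatively compact or relatively weakly compact sets. Equivalently, [T]
    converges, in norm or weakly, along every ultrafilter that contains [A]
    ([precompact_imageP]); this is visibly linear in [T], and it passes to
    operator-norm limits because the limits along a fixed ultrafilter of nearby
    operators are close in norm ([closed_subspace_precompact] and
    [closed_subspace_weakly_precompact]). *)

Set Implicit Arguments. Unset Strict Implicit. Unset Printing Implicit Defensive.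
Import Order.TTheory GRing.Theory Num.Theory.
Import numFieldNormedType.Exports.
Local Open Scope classical_set_scope.
Local Open Scope ring_scope.

(** * Norming functionals and bounded null sequences *)

Section norming_functional.
Context {R : realType} {X : normedModType R}.
Implicit Types (x y z : X) (r s t : R) (G : set (X * R)).

(** Partial linear functionals on [X] are handled as graphs in [X * R], so that
    their union along a chain is a plain union of sets. *)
Definition linear_graph G :=
  forall a u v, G u -> G v -> G (a *: u.1 + v.1, a * u.2 + v.2).

(** On a linear graph this also forces functionality: it gives [r <= 0] for every
    [(0, r)] in the graph, hence [r = 0] by linearity. *)
Definition dominated_graph G := forall u, G u -> u.2 <= `|u.1|.

Definition extend_graph G (w : X * R) : set (X * R) :=
  [set u | exists v t, G v /\ u = (v.1 + t *: w.1, v.2 + t * w.2)].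

Lemma extend_linear_graph G w : linear_graph G -> linear_graph (extend_graph G w).
Proof.
move=> lG a _ _ [u [s [Gu ->]]] [v [t [Gv ->]]].
exists (a *: u.1 + v.1, a * u.2 + v.2), (a * s + t); split; first exact: lG.
congr pair; rewrite /= ?scalerDr ?scalerDl ?scalerA; first by rewrite addrACA.
by ring.
Qed.

(** The one-dimensional step of the Hahn-Banach theorem: the value [r] at [y] must
    lie between all [s - |z - y|] and all [|z + y| - s] with [(z, s)] in [G];
    by the triangle inequality no lower bound exceeds an upper one. *)
Lemma extend_dominated_graph G y :
  linear_graph G -> dominated_graph G -> G !=set0 ->
  exists r, dominated_graph (extend_graph G (y, r)).
Proof.
move=> lG dG [g0 Gg0].
have sep u v : G u -> G v -> u.2 - `|u.1 - y| <= `|v.1 + y| - v.2.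
  move=> Gu Gv; rewrite lerBlDr addrAC -lerBlDr opprK.
  have := dG _ (lG 1 _ _ Gu Gv); rewrite /= mul1r scale1r => /le_trans; apply.
  have -> : u.1 + v.1 = (v.1 + y) + (u.1 - y).
    by rewrite addrACA subrr addr0 addrC.
  exact: ler_normD.
pose L := [set u.2 - `|u.1 - y| | u in G].
have supL : has_sup L.
  split; first by exists (g0.2 - `|g0.1 - y|), g0.
  by exists (`|g0.1 + y| - g0.2) => _ [u Gu <-]; exact: sep.
exists (sup L) => _ [v [t [Gv ->]]] /=.
have scaled c : G (c *: v.1, c * v.2).
  have := lG c _ _ Gv (lG (- 1) _ _ Gg0 Gg0).
  by rewrite /= scaleN1r addNr mulN1r addNr !addr0.
have [t0|t0|->] := ltgtP t 0; last first.
- by rewrite mul0r scale0r !addr0 dG.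
- have /(ge_sup supL.1) : ubound L (`|t^-1 *: v.1 + y| - t^-1 * v.2).
    by move=> _ [u Gu <-]; exact: sep (scaled t^-1).
  rewrite lerBrDr -(ler_pM2l t0) mulrDr mulVKf ?gt_eqF// addrC => /le_trans.
  apply; rewrite -{1}(gtr0_norm t0) -normrZ scalerDr scalerA divff ?gt_eqF//.
  by rewrite scale1r.
- have Nt0 : 0 < - t by rewrite oppr_gt0.
  have : L ((- t)^-1 * v.2 - `|(- t)^-1 *: v.1 - y|).
    by exists ((- t)^-1 *: v.1, (- t)^-1 * v.2) => //; exact: scaled.
  move=> /(sup_upper_bound supL); rewrite lerBlDr -lerBlDl -(ler_pM2l Nt0).
  rewrite mulrBr mulVKf ?gt_eqF// mulNr opprK => /le_trans.
  apply; rewrite -{1}(gtr0_norm Nt0) -normrZ scalerBr scalerA divff ?gt_eqF//.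
  by rewrite scale1r scaleNr opprK.
Qed.

(** The special case of the Hahn-Banach theorem that the duality arguments need,
    by Zorn's lemma on dominated linear graphs. *)
Lemma norming_functional x : exists f : dual X, `|f| <= 1 /\ f x = `|x|.
Proof.
(* The empty graph is admitted because it is the union of the empty chain; it is
   not maximal, since the graph on the line through x extends it. *)
pose P G := [/\ linear_graph G, dominated_graph G & G = set0 \/ G (x, `|x|)].
pose line := [set u : X * R | exists t, u = (t *: x, t * `|x|)].
have Pline : P line.
  split; last by right; exists 1; rewrite scale1r mul1r.
    move=> a _ _ [s ->] [t ->]; exists (a * s + t) => /=.
    by rewrite scalerDl mulrDl scalerA mulrA.
  by move=> _ [t ->] /=; rewrite normrZ ler_wpM2r// ler_norm.
have [G [[lG dG G0] maxG]] : exists G, P G /\ forall H, G `<` H -> ~ P H.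
  apply: Zorn_bigcup => F FP Ftot; split.
  - move=> a u v [G FG Gu] [H FH Hv].
    have [GH|HG] := Ftot _ _ FG FH.
      by exists H => //; have [lH _ _] := FP _ FH; apply: lH => //; exact: GH.
    by exists G => //; have [lG _ _] := FP _ FG; apply: lG => //; exact: HG.
  - by move=> u [G FG Gu]; have [_ dG _] := FP _ FG; exact: dG.
  - have [[G [FG GN0]]|N] := pselect (exists G, F G /\ G != set0); last first.
      left; rewrite -subset0 => u [G FG Gu]; apply: N; exists G; split => //.
      by apply/set0P; exists u.
    right; exists G => //; have [_ _ [G0|//]] := FP _ FG.
    by rewrite G0 eqxx in GN0.
have Gx : G (x, `|x|).
  case: G0 => [G0|//]; exfalso; apply: (maxG line) => //.
  rewrite G0; split=> [u []|/(_ (1 *: x, 1 * `|x|))]; apply; by exists 1.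
have total y : exists r, G (y, r).
  have [|r dGr] := extend_dominated_graph y lG dG; first by exists (x, `|x|).
  have sub : G `<=` extend_graph G (y, r).
    by move=> [u s] Gu; exists (u, s), 0; rewrite /= scale0r mul0r !addr0.
  exists r; apply: contrapT => Gyr.
  apply: (maxG (extend_graph G (y, r))).
    split=> // /(_ (y, r)) H; apply/Gyr/H.
    exists (1 *: (- x) + x, 1 * (- `|x|) + `|x|), 1.
    rewrite /= !scale1r !mul1r !addNr !add0r; split => //.
    have := lG (-1) _ _ Gx Gx; rewrite /= scaleN1r mulN1r !addNr; exact.
  by split => //; [exact: extend_linear_graph|right; exact: sub].
have [f fG] := choice total.
have uniq y r : G (y, r) -> r = f y.
  have le0 s : G (0, s) -> s <= 0 by move=> /dG; rewrite normr0.
  move=> Gyr; have := lG (- 1) _ _ Gyr (fG y); have := lG (- 1) _ _ (fG y) Gyr.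
  rewrite /= !scaleN1r !mulN1r !addNr => /le0 + /le0.
  rewrite ![- _ + _]addrC !subr_le0 => ? ?.
  by apply/eqP; rewrite eq_le; apply/andP.
have f_linear : linear f.
  by move=> a u v; apply/esym/uniq; exact: lG (fG u) (fG v).
have f_le y : `|f y| <= `|y|.
  rewrite ler_norml; apply/andP; split; last exact: dG (fG y).
  have -> : f y = - f (- y).
    have := f_linear (- 1) y 0; rewrite addr0 scaleN1r => ->.
    have := f_linear (- 1) 0 0; rewrite scaler0 addr0 scaleN1r addNr => ->.
    by rewrite addr0 scaleN1r opprK.
  by rewrite lerN2 -normrN; exact: dG (fG (- y)).
have f_bl : (f : X -> R) \in bounded_linear.
  by apply/asboolP; split => //; exists 1 => y; rewrite mul1r.
exists (Bop f_bl : dual X); split; last exact/esym/uniq.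
by apply: bop_norm_le => // y; rewrite mul1r; exact: f_le.
Qed.

End norming_functional.

Lemma dual_norm_le {R : realType} {X : normedModType R} (x : X) (c : R) :
  0 <= c -> (forall f : dual X, `|f x| <= c * `|f|) -> `|x| <= c.
Proof.
move=> c0 xc; have [f [f1 fx]] := norming_functional x.
by have := xc f; rewrite fx normr_id => /le_trans; apply; rewrite ler_piMr.
Qed.

Lemma pointwise_bounded_bop {R : realType} (X : completeNormedModType R)
    (Y : normedModType R) (T : nat -> bop X Y) :
  (forall x, exists M : R, forall n, `|T n x| <= M) ->
  exists2 M : R, 0 <= M & forall n, `|T n| <= M.
Proof.
move=> Tx.
pose F := [set f : X -> Y | exists n, f = T n :> (X -> Y)].
have [|x|M TM] := @Banach_Steinhauss R X Y F _ _ 1.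
- move=> _ [n ->]; split; last exact: bop_linear.
  move=> r; exists (`|T n| * `|r|) => x xr.
  rewrite (le_trans (bop_normP _ _))// ler_wpM2l// (le_trans xr)//.
  exact: ler_norm.
- by have [M TM] := Tx x; exists M => _ [n ->].
have M0 : 0 <= M.
  apply: le_trans (TM (T 0%N) _ 0 _) => //; first by exists 0%N.
  by rewrite normr0.
exists M => // n; apply: opnorm_le => // x.
have [->|x0] := eqVneq x 0; first by rewrite linear0 !normr0 mulr0.
have xp : 0 < `|x| by rewrite normr_gt0.
have : `|T n (`|x|^-1 *: x)| <= M.
  apply: TM; first by exists n.
  by rewrite normrZ gtr0_norm ?invr_gt0// mulVf ?lt0r_neq0.
by rewrite linearZ/= normrZ gtr0_norm ?invr_gt0// mulrC ler_pdivrMr.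
Qed.

Lemma cvg_bounded_seq {R : realType} (X : normedModType R) (x : nat -> X)
    (l : X) :
  x @ \oo --> l -> exists M : R, forall n, `|x n| <= M.
Proof.
move=> xl; have [M [_ xM]] : bounded_fun x.
  by apply: cvg_seq_bounded; apply/cvg_ex; exists l.
by exists (M + 1) => n; apply: (xM (M + 1)) => //; rewrite ltrDl.
Qed.

Lemma wstar_null_bounded {R : realType} (X : completeNormedModType R)
    (f : nat -> dual X) :
  wstar_null f -> exists2 M : R, 0 <= M & forall n, `|f n| <= M.
Proof.
by move=> f0; apply: pointwise_bounded_bop => x; exact: cvg_bounded_seq (f0 x).
Qed.

Lemma eval_bounded_linear {R : realType} {X : normedModType R} (x : X) :
  ((fun f : dual X => f x) : dual X -> R) \in bounded_linear.
Proof.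
apply/asboolP; split=> [a f g|]; first by rewrite bopDE bopZE.
by exists `|x| => f; rewrite mulrC bop_normP.
Qed.

Definition eval {R : realType} {X : normedModType R} (x : X) : dual (dual X) :=
  Bop (eval_bounded_linear x).

(** Banach-Steinhaus is applied on the dual, which is complete even when [X] is
    not; the bidual norm of [x n] is its norm because of norming functionals. *)
Lemma w_null_bounded {R : realType} (X : normedModType R) (x : nat -> X) :
  w_null x -> exists2 M : R, 0 <= M & forall n, `|x n| <= M.
Proof.
move=> x0.
have [M M0 xM] : exists2 M : R, 0 <= M & forall n, `|eval (x n)| <= M.
  by apply: pointwise_bounded_bop => f; exact: cvg_bounded_seq (x0 f).
exists M => // n; apply: dual_norm_le => // f.
by rewrite (le_trans (bop_normP (eval (x n)) f))// ler_wpM2r.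
Qed.

(** * Completeness from rapidly convergent series *)

Lemma cvg_div_exp2 {R : realType} (c : R) :
  (fun n => c / 2 ^+ n) @ \oo --> (0 : R).
Proof.
rewrite -(mulr0 c); apply: cvgMr.
rewrite (_ : (fun n => _) = GRing.exp 2^-1); last first.
  by apply/funext => n; rewrite exprVn.
by apply: cvg_expr; rewrite ger0_norm ?invf_lt1// ltr1n.
Qed.

Lemma cvg_dominated_series {R : realType} (V : completeNormedModType R)
    (u : nat -> V) (c : R) : (forall n, `|u n| <= c / 2 ^+ n) ->
  exists s : V, forall n, `|s - \sum_(k < n) u k| <= c * 2 / 2 ^+ n.
Proof.
move=> uc.
have tail n m : (n <= m)%N ->
    `|\sum_(k < m) u k - \sum_(k < n) u k| <= c * 2 / 2 ^+ n - c * 2 / 2 ^+ m.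
  elim: m => [|m IH]; first by rewrite leqn0 => /eqP->; rewrite !subrr normr0.
  rewrite leq_eqVlt ltnS => /predU1P[->|/IH{}IH]; first by rewrite !subrr normr0.
  rewrite big_ord_recr/= addrAC (le_trans (ler_normD _ _))//.
  rewrite (le_trans (lerD IH (uc m)))// exprS.
  by rewrite invfM [_ * (2^-1 * _)]mulrA mulfK//; lra.
have c0 : 0 <= c.
  by have := le_trans (normr_ge0 _) (uc 0%N); rewrite expr0 divr1.
have tail' n m : (n <= m)%N ->
    `|\sum_(k < m) u k - \sum_(k < n) u k| <= c * 2 / 2 ^+ n.
  move=> /tail/le_trans; apply; rewrite lerBlDr lerDl.
  by rewrite divr_ge0 ?mulr_ge0// exprn_ge0.
have c2 := cvg_div_exp2 (c * 2).
have cv : cvg ((fun m => \sum_(k < m) u k) @ \oo).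
  apply: cauchy_cvg; apply: cauchy_exP => e e0.
  have /cvgrPdist_lt/(_ e e0)[n _ /(_ n (leqnn n))] := c2.
  rewrite /= sub0r normrN => cn.
  exists (\sum_(k < n) u k); exists n => // m /= nm.
  rewrite -ball_normE /ball_/= distrC (le_lt_trans (tail' _ _ nm))//.
  exact: le_lt_trans (ler_norm _) cn.
exists (lim ((fun m => \sum_(k < m) u k) @ \oo)) => n.
have /cvg_norm cn : (fun m => \sum_(k < m) u k - \sum_(k < n) u k) @ \oo -->
  lim ((fun m => \sum_(k < m) u k) @ \oo) - \sum_(k < n) u k.
  by apply: cvgB => //; exact: cvg_cst.
by apply: cvgr_to_le cn _; exists n => // m; exact: tail'.
Qed.

Section banach_under_criterion.
Context {R : realType} {V : lmodType R} (W : set V) (N : V -> R).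
Context (W0 : W 0)
  (W_linear : forall a x y, W x -> W y -> W (a *: x + y))
  (N_D : forall x y, W x -> W y -> N (x + y) <= N x + N y)
  (N_Z : forall a x, W x -> N (a *: x) = `|a| * N x)
  (N_eq0 : forall x, W x -> N x = 0 -> x = 0).

Definition subspace_pred : {pred V} := fun x => `[< W x >].

Lemma subspace_pred_closed : submod_closed subspace_pred.
Proof.
split; first exact/asboolP.
by move=> a x y /asboolP Wx /asboolP Wy; exact/asboolP/W_linear.
Qed.

HB.instance Definition _ :=
  GRing.isSubmodClosed.Build R V subspace_pred subspace_pred_closed.

(** A copy of [W] as a type of its own, since [V] may already carry a norm that
    differs from [N]. *)
Record subspace_type :=
  SubspaceType { subspace_val :> V ; _ : subspace_val \in subspace_pred }.

HB.instance Definition _ := [isSub for subspace_val].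
HB.instance Definition _ := [Choice of subspace_type by <:].
HB.instance Definition _ := [SubChoice_isSubLmodule of subspace_type by <:].

Lemma subspace_valP (x : subspace_type) : W x.
Proof. by case: x => x /= /asboolP. Qed.

Definition subspace_norm (x : subspace_type) : R := N x.

Lemma subspace_normD x y :
  subspace_norm (x + y) <= subspace_norm x + subspace_norm y.
Proof. by apply: N_D; exact: subspace_valP. Qed.

Lemma subspace_normZ a x : subspace_norm (a *: x) = `|a| * subspace_norm x.
Proof. by apply: N_Z; exact: subspace_valP. Qed.

Lemma subspace_norm_eq0 x : subspace_norm x = 0 -> x = 0.
Proof. by move=> /N_eq0 x0; apply/val_inj/x0/subspace_valP. Qed.

HB.instance Definition _ := Lmodule_isNormed.Build R subspace_type
  subspace_normD subspace_normZ subspace_norm_eq0.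

Context (W_series : forall u : nat -> V,
  (forall n, W (u n)) -> (forall n, N (u n) <= 1 / 2 ^+ n) ->
  exists s c, W s /\ forall n, N (s - \sum_(k < n) u k) <= c / 2 ^+ n).

(** Centres of balls of radius [1 / 2 ^+ n.+1] that belong to the Cauchy filter
    have differences as small as [W_series] asks for; the sum of those
    differences is the limit. *)
Lemma subspace_complete (G : set_system subspace_type) :
  ProperFilter G -> cauchy G -> cvg G.
Proof.
move=> GG /cauchyP Gc.
have r0 n : 0 < 1 / 2 ^+ n.+1 :> R by rewrite divr_gt0// exprn_gt0.
have [x xG] := choice (fun n => Gc _ (r0 n)).
have xx n : `|x n.+1 - x n| <= 1 / 2 ^+ n.
  have /filter_ex[y []] :
      G (ball (x n) (1 / 2 ^+ n.+1) `&` ball (x n.+1) (1 / 2 ^+ n.+2)).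
    exact: filterI (xG n) (xG n.+1).
  rewrite -!ball_normE /ball_/= => /ltW xy /ltW xy'.
  rewrite -(subrKA y) (le_trans (ler_normD _ _))// [X in _ + X]distrC.
  rewrite (le_trans (lerD xy' xy))// !exprS !invfM.
  have : 0 < (2 ^+ n)^-1 :> R by rewrite invr_gt0 exprn_gt0.
  by lra.
have [|n|s [c [Ws sc]]] := @W_series (fun n => val (x n.+1 - x n)).
- by move=> n; exact: subspace_valP.
- exact: xx.
have sW : s \in subspace_pred by exact/asboolP.
pose y : subspace_type := x 0%N + SubspaceType sW.
have yx n : `|y - x n| <= c / 2 ^+ n.
  suff -> : y - x n = SubspaceType sW - \sum_(k < n) (x k.+1 - x k).
    by have := sc n; rewrite -[s]/(val (SubspaceType sW)) -raddf_sum -raddfB.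
  rewrite -(big_mkord xpredT (fun k => x k.+1 - x k)) telescope_sumr//.
  by rewrite /y opprB addrA [_ + x 0%N]addrC.
apply/cvg_ex; exists y; apply/cvgrPdist_le => e e0.
have /cvgrPdist_le/(_ e e0)[n _ /(_ n (leqnn n))] := cvg_div_exp2 (c + 1).
rewrite /= sub0r normrN => /(le_trans (ler_norm _)) ne.
apply: filterS (xG n) => z; rewrite -ball_normE /ball_/= => /ltW xz.
rewrite -(subrKA (x n)) (le_trans (ler_normD _ _))// (le_trans _ ne)//.
rewrite mulrDl lerD// (le_trans xz)// ler_wpM2l// lef_pV2 ?posrE ?exprn_gt0//.
by rewrite exprS ler_peMl ?ler1n// exprn_ge0.
Qed.

HB.instance Definition _ :=
  Uniform_isComplete.Build subspace_type subspace_complete.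

Lemma subspace_val_linear : linear subspace_val.
Proof. by []. Qed.

HB.instance Definition _ :=
  GRing.isLinear.Build R subspace_type V _ subspace_val subspace_val_linear.

(** A normed space is complete as soon as its series with terms of norm at most
    [2 ^- n] converge at a geometric rate. *)
Lemma banach_under_of_series : banach_under W N.
Proof.
exists subspace_type, subspace_val; split=> //; split=> [x _|x y _ _|x Wx].
- exact: subspace_valP.
- exact: val_inj.
- have xW : x \in subspace_pred by exact/asboolP.
  by exists (SubspaceType xW).
Qed.

End banach_under_criterion.

(** * Operators dominated by a positive operator *)

(** If [y] is positive then [- x <= y - x], hence the positive part of [- x] has
    norm at most [|x - y|]. *)
Lemma ge0_approx {R : realType} {E : banachLatticeType R} (x : E) :
  (forall e : R, 0 < e -> exists2 y, 0 <=o y & `|x - y| <= e) -> 0 <=o x.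
Proof.
move=> xP; suff /normr0_eq0 x0 : `|ppos (- x)| = 0.
  by rewrite (ppos_sub x) x0 subr0; exact: ppos_ge0.
apply/eqP; rewrite eq_le normr_ge0 andbT; apply/ler_addgt0Pr => e /xP[y y0 xy].
rewrite add0r (le_trans _ xy)// distrC -[leRHS]norm_modulus.
apply: ge0_le_norm; first exact: ppos_ge0.
apply: bl_join_le; last exact: modulus_ge0.
apply: bl_le_trans (le_modulus _); rewrite -[X in X <=o _]add0r.
exact: bl_leD2r.
Qed.

Section dominated_op.
Context {R : realType} {E F : banachLatticeType R}.
Implicit Types (x y : E) (S T : bop E F).

Lemma positive_op_approx T :
  (forall e : R, 0 < e -> exists2 S, positive_op S & `|T - S| <= e) ->
  positive_op T.
Proof.
move=> TP x x0; apply: ge0_approx => e e0.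
have x1 : 0 < `|x| + 1 by rewrite ltr_wpDl.
have [S S0 TS] := TP _ (divr_gt0 e0 x1); exists (S x); first exact: S0.
rewrite -[T x - S x]/((T - S) x) (le_trans (bop_normP _ _))//.
rewrite (le_trans (ler_wpM2r (normr_ge0 x) TS))// mulrAC ler_pdivrMr//.
by rewrite ler_wpM2l ?lerDl// ltW.
Qed.

Lemma op_le_approx T S :
  (forall e : R, 0 < e -> exists T' S',
     [/\ op_le T' S', `|T - T'| <= e & `|S - S'| <= e]) -> op_le T S.
Proof.
move=> TS; apply: positive_op_approx => e e0.
have e2 : 0 < e / 2 by rewrite divr_gt0.
have [T' [S' [TS' TT' SS']]] := TS _ e2; exists (S' - T') => //.
have -> : S - T - (S' - T') = (S - S') - (T - T').
  by rewrite !opprB addrACA [RHS]addrACA [- T + _]addrC.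
by rewrite (le_trans (ler_normB _ _))// [leRHS]splitr lerD.
Qed.

Definition dominated T S := op_le T S /\ op_le (- T) S.

Lemma dominatedE T S : dominated T S ->
  forall x, 0 <=o x -> T x <=o S x /\ - T x <=o S x.
Proof.
move=> [TS NTS] x x0; split; apply/bl_subr_ge0; first exact: TS.
exact: NTS.
Qed.

Lemma dominatedI T S :
  (forall x, 0 <=o x -> T x <=o S x /\ - T x <=o S x) -> dominated T S.
Proof.
move=> TS; split=> x /TS[xTS xNTS].
  by rewrite bopDE bopNE; apply/bl_subr_ge0.
by rewrite bopDE !bopNE; apply/bl_subr_ge0.
Qed.

(** Splitting [x] into its positive and negative parts gives
    [|T x| <= S |x|], and the lattice norm is monotone. *)
Lemma dominated_norm T S : dominated T S -> `|T| <= `|S|.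
Proof.
move=> TS; apply: bop_norm_le => // x.
suff : `|T x| <= `|S (modulus x)|.
  by move/le_trans; apply; rewrite -[in leRHS](norm_modulus x) bop_normP.
apply: bl_le_norm; rewrite -!/(modulus _).
have S0 y : 0 <=o y -> 0 <=o S y.
  move=> y0; have [Ty NTy] := dominatedE TS y0.
  rewrite -[S y](scalerK (lt0r_neq0 (ltr0Sn R 1))) scaler_nat mulr2n.
  by apply: bl_scaler_ge0 => //; rewrite -(subrr (T y)); exact: bl_leD.
rewrite (ge0_modulus (S0 _ (modulus_ge0 x))) [modulus x]modulusE linearD.
have [p1 p2] := dominatedE TS (ppos_ge0 x).
have [n1 n2] := dominatedE TS (ppos_ge0 (- x)).
apply: bl_join_le; rewrite {1}(ppos_sub x) linearB/=; first exact: bl_leD.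
by rewrite opprB addrC; exact: bl_leD.
Qed.

Lemma dominated0 : dominated 0 0.
Proof.
by apply: dominatedI => x _; rewrite -[(0 : bop E F) x]/(0 : F) oppr0;
  split; exact: bl_le_refl.
Qed.

Lemma dominatedD T1 T2 S1 S2 :
  dominated T1 S1 -> dominated T2 S2 -> dominated (T1 + T2) (S1 + S2).
Proof.
move=> TS1 TS2; apply: dominatedI => x x0; rewrite !bopDE opprD.
have [p1 p2] := dominatedE TS1 x0; have [q1 q2] := dominatedE TS2 x0.
by split; exact: bl_leD.
Qed.

Lemma dominatedZ a T S : dominated T S -> dominated (a *: T) (`|a| *: S).
Proof.
move=> TS; apply: dominatedI => x x0; rewrite !bopZE.
have [p1 p2] := dominatedE TS x0.
have [a0|a0] := leP 0 a.
  by rewrite ?(ger0_norm a0) -scalerN; split; exact: bl_leZ.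
have Na0 : 0 <= - a by rewrite oppr_ge0 ltW.
rewrite ltr0_norm// -scaleNr; split; last exact: bl_leZ.
by rewrite -[a *: T x]opprK -scaleNr -scalerN; exact: bl_leZ.
Qed.

(** The positive cone of operators is closed for the operator norm; this is how
    a domination passes from partial sums to the sum of a series. *)
Lemma dominated_approx T S :
  (forall e : R, 0 < e -> exists T' S',
     [/\ dominated T' S', `|T - T'| <= e & `|S - S'| <= e]) -> dominated T S.
Proof.
move=> TS; split; apply: op_le_approx => e /TS[T' [S' [[TS' NTS'] TT' SS']]].
  by exists T', S'.
by exists (- T'), S'; rewrite -opprD normrN.
Qed.

End dominated_op.

(** * The enveloping norm of a closed subspace of operators *)

Section regularly.
Context {R : realType} {E F : banachLatticeType R}.
Implicit Types (S T : bop E F) (P : set (bop E F)).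

(** Closedness is for the operator norm, phrased through approximation so that it
    can be checked and used without choosing sequences. *)
Definition closed_subspace P :=
  [/\ P 0, forall a S T, P S -> P T -> P (a *: S + T) &
      forall T, (forall e : R, 0 < e -> exists2 S, P S & `|T - S| <= e) -> P T].

Section enveloping.
Context (P : set (bop E F)) (Pcs : closed_subspace P).

Let P0 : P 0. Proof. by case: Pcs. Qed.
Let P_linear a S T : P S -> P T -> P (a *: S + T).
Proof. by case: Pcs => _ + _; exact. Qed.
Let P_approx T :
  (forall e : R, 0 < e -> exists2 S, P S & `|T - S| <= e) -> P T.
Proof. by case: Pcs => _ _; exact. Qed.
Let PD S T : P S -> P T -> P (S + T).
Proof. by move=> PS; rewrite -[S in P (S + _)]scale1r; exact: P_linear. Qed.
Let PZ a S : P S -> P (a *: S).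
Proof. by move=> PS; rewrite -[_ *: _]addr0; exact: P_linear. Qed.
Let P_sum (u : nat -> bop E F) n : (forall k, P (u k)) -> P (\sum_(k < n) u k).
Proof. by move=> Pu; elim/big_ind: _ => // S T; exact: PD. Qed.

(** From [T = T1 - T2] one gets the dominating [T1 + T2]; conversely
    [T = (S + T) / 2 - (S - T) / 2]. *)
Lemma regularlyP T :
  regularly P T <-> P T /\ exists2 S, P S & dominated T S.
Proof.
split=> [[T1 [T2 [PT1 T10 PT2 T20 ->]]]|[PT [S PS [TS NTS]]]].
  have PN : P (T1 - T2) by rewrite -scaleN1r addrC; exact: P_linear.
  split=> //; exists (T1 + T2); first exact: PD.
  have N_le y : 0 <=o y -> - y <=o y.
    move=> y0; apply: (bl_le_trans 0) => //.
    by rewrite -[X in _ <=o X]oppr0; exact: bl_leN.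
  apply: dominatedI => x x0; rewrite !bopDE bopNE opprB addrC.
  have [/N_le NT1 /N_le NT2] := (T10 x x0, T20 x x0).
  by split; rewrite addrC; apply: bl_leD => //; exact: bl_le_refl.
exists (2^-1 *: (S + T)), (2^-1 *: (S - T)).
have half0 U : positive_op U -> positive_op (2^-1 *: U).
  by move=> U0 x /U0; apply: bl_scaler_ge0.
move: NTS; rewrite /op_le opprK => NTS.
split; [exact/PZ/PD|exact: half0| |exact: half0|].
  by apply: PZ; rewrite -scaleN1r addrC; exact: P_linear.
rewrite -scalerBr opprB addrC addrA subrK -[T + T]mulr2n -[T *+ 2]scaler_nat.
by rewrite scalerA mulVf// scale1r.
Qed.

Let N := enveloping_norm P.

Let N_has_lbound T :
  has_lbound [set `|S| | S in [set S | [/\ op_le T S, op_le (- T) S & P S]]].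
Proof. by exists 0 => _ [S _ <-]. Qed.

Lemma enveloping_norm_le S T : P S -> dominated T S -> N T <= `|S|.
Proof. by move=> PS [TS NTS]; apply: ge_inf => //; exists S. Qed.

Lemma enveloping_norm_lt T c : regularly P T -> N T < c ->
  exists S, [/\ P S, dominated T S & `|S| < c].
Proof.
move=> /regularlyP[PT [S0 PS0 [TS0 NTS0]]] /inf_lt[|_ [S [TS NTS PS] <-] Sc].
  by exists `|S0|, S0.
by exists S.
Qed.

Lemma regularly0 : regularly P 0.
Proof. by apply/regularlyP; split=> //; exists 0 => //; exact: dominated0. Qed.

Lemma regularly_linear a S T :
  regularly P S -> regularly P T -> regularly P (a *: S + T).
Proof.
move=> /regularlyP[PS [U PU SU]] /regularlyP[PT [V PV TV]].
apply/regularlyP; split; first exact: P_linear.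
exists (`|a| *: U + V); first exact: P_linear.
by apply: dominatedD => //; exact: dominatedZ.
Qed.

Lemma enveloping_normD S T : regularly P S -> regularly P T ->
  N (S + T) <= N S + N T.
Proof.
move=> rS rT; apply/ler_addgt0Pr => e e0.
have e2 : 0 < e / 2 by rewrite divr_gt0.
have [|U [PU SU Ul]] := enveloping_norm_lt rS (c := N S + e / 2).
  by rewrite ltrDl.
have [|V [PV TV Vl]] := enveloping_norm_lt rT (c := N T + e / 2).
  by rewrite ltrDl.
apply: le_trans (enveloping_norm_le (PD PU PV) (dominatedD SU TV)) _.
rewrite (le_trans (ler_normD _ _))// (le_trans (lerD (ltW Ul) (ltW Vl)))//.
by rewrite addrACA -splitr.
Qed.

Lemma norm_le_enveloping_norm T : regularly P T -> `|T| <= N T.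
Proof.
move=> rT; apply/ler_addgt0Pr => e e0.
have [|U [_ TU Ul]] := enveloping_norm_lt rT (c := N T + e).
  by rewrite ltrDl.
exact: le_trans (dominated_norm TU) (ltW Ul).
Qed.

Lemma enveloping_normZ a T : regularly P T -> N (a *: T) = `|a| * N T.
Proof.
have le b S : regularly P S -> N (b *: S) <= `|b| * N S.
  move=> rS; apply/ler_addgt0Pr => e e0.
  have b1 : 0 < `|b| + 1 by rewrite ltr_wpDl.
  have [|U [PU SU Ul]] := enveloping_norm_lt rS (c := N S + e / (`|b| + 1)).
    by rewrite ltrDl divr_gt0.
  apply: le_trans (enveloping_norm_le (PZ `|b| PU) (dominatedZ b SU)) _.
  rewrite normrZ normr_id (le_trans (ler_wpM2l (normr_ge0 b) (ltW Ul)))//.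
  rewrite mulrDr lerD2l mulrCA; apply: ler_piMr; first exact: ltW.
  by rewrite ler_pdivrMr// mul1r lerDl.
move=> rT; apply/eqP; rewrite eq_le le//=.
have rZ : regularly P (a *: T).
  by rewrite -[_ *: _]addr0; apply: regularly_linear => //; exact: regularly0.
have [a0|a0] := eqVneq a 0.
  have -> : `|a| = 0 by rewrite a0 normr0.
  by rewrite mul0r (le_trans _ (norm_le_enveloping_norm rZ)).
rewrite -ler_pdivlMl ?normr_gt0// -normfV -[in leLHS](scalerK a0 T).
exact: le.
Qed.

Lemma enveloping_norm_eq0 T : regularly P T -> N T = 0 -> T = 0.
Proof.
move=> /norm_le_enveloping_norm + N0; rewrite N0 normr_le0 => /eqP; exact.
Qed.

(** Choose [S n] in [P] dominating [u n] with nearly optimal norm. Both series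
    converge in operator norm, and each tail of the [S] series lies in [P] and
    dominates the corresponding tail of the [u] series; hence the tails of [u]
    are small for the enveloping norm, not merely for the operator norm. *)
Lemma regularly_series (u : nat -> bop E F) :
  (forall n, regularly P (u n)) -> (forall n, N (u n) <= 1 / 2 ^+ n) ->
  exists s c, regularly P s /\
    forall n, N (s - \sum_(k < n) u k) <= c / 2 ^+ n.
Proof.
move=> ru Nu.
have p2 n : 0 < 2 ^+ n :> R by rewrite exprn_gt0.
have /choice[S SP] n :
    exists S, [/\ P S, dominated (u n) S & `|S| <= 2 / 2 ^+ n].
  have [|S [PS uS Sn]] := enveloping_norm_lt (ru n) (c := 2 / 2 ^+ n).
    by rewrite (le_lt_trans (Nu n))// ltr_pM2r ?invr_gt0// ltr1n.
  by exists S; split=> //; exact: ltW.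
have PS n : P (S n) by case: (SP n).
have uS n : dominated (u n) (S n) by case: (SP n).
have S_le n : `|S n| <= 2 / 2 ^+ n by case: (SP n).
have u_le n : `|u n| <= 2 / 2 ^+ n := le_trans (dominated_norm (uS n)) (S_le n).
have [s s_le] := cvg_dominated_series u_le.
have [t t_le] := cvg_dominated_series S_le.
have small (e : R) : 0 < e -> exists m0, forall m,
    (m0 <= m)%N -> 2 * 2 / 2 ^+ m <= e.
  move=> e0; have /cvgrPdist_le/(_ e e0)[m0 _ me] := cvg_div_exp2 (2 * 2 : R).
  exists m0 => m /me /=; rewrite sub0r normrN; exact/le_trans/ler_norm.
have P_lim (w : bop E F) (v : nat -> bop E F) : (forall n, P (v n)) ->
    (forall n, `|w - \sum_(k < n) v k| <= 2 * 2 / 2 ^+ n) -> P w.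
  move=> Pv wv; apply: P_approx => e /small[m /(_ m (leqnn m)) me].
  exists (\sum_(k < m) v k); first exact: P_sum.
  exact: le_trans (wv m) me.
have tail n : dominated (s - \sum_(k < n) u k) (t - \sum_(k < n) S k).
  (* Finite sums over [n, m) approximate both tails within e once m is large. *)
  apply: dominated_approx => e /small[m0 /(_ (maxn m0 n) (leq_maxl _ _))].
  have := leq_maxr m0 n; move: (maxn m0 n) => m nm me.
  have split_sum (v : nat -> bop E F) w :
      w - \sum_(k < n) v k - \sum_(n <= k < m) v k = w - \sum_(k < m) v k.
    by rewrite -addrA -opprD -!(big_mkord xpredT v) (@big_cat_nat _ _ _ n 0 m).
  exists (\sum_(n <= k < m) u k), (\sum_(n <= k < m) S k).
  rewrite !split_sum; split; [|exact: le_trans (s_le m) me|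
                               exact: le_trans (t_le m) me].
  by elim/big_ind2: _ => // [|? ? ? ?]; [exact: dominated0|exact: dominatedD].
have Pu n : P (u n) by have /regularlyP[] := ru n.
have Pt n : P (t - \sum_(k < n) S k).
  rewrite addrC -scaleN1r; apply: P_linear; first exact: P_sum.
  exact: P_lim t_le.
exists s, (2 * 2); split; last first.
  by move=> n; rewrite (le_trans (enveloping_norm_le (Pt n) (tail n))).
apply/regularlyP; split; first exact: P_lim s_le.
exists t; first by have := Pt 0%N; rewrite big_ord0 subr0.
by have := tail 0%N; rewrite !big_ord0 !subr0.
Qed.

End enveloping.

Theorem regularly_banach P :
  closed_subspace P -> banach_under (regularly P) (enveloping_norm P).
Proof.
move=> Pcs; apply: banach_under_of_series.
- exact: regularly0.
- exact: regularly_linear.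
- exact: enveloping_normD.
- exact: enveloping_normZ.
- exact: enveloping_norm_eq0.
- exact: regularly_series.
Qed.

End regularly.

(** * Classes defined by null sequences *)

Section closed_subspaces.
Context {R : realType} {E F : banachLatticeType R}.
Implicit Types (S T : bop E F).

Lemma closed_subspace_forall (I : Type) (P : I -> bop E F -> Prop) :
  (forall i, closed_subspace [set T | P i T]) ->
  closed_subspace [set T | forall i, P i T].
Proof.
move=> Pi; split=> [i|a S T PS PT i|T PT i]; have [P0 PD PL] := Pi i.
- exact: P0.
- by apply: PD; [exact: PS|exact: PT].
- by apply: PL => e /PT[S PS ST]; exists S => //; exact: PS.
Qed.

(** The seminorms [q n] are bounded by one multiple of the operator norm, so a
    small perturbation of [T] changes all the [q n T] by a uniformly small
    amount, and their convergence to [0] survives limits in [T]. *)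
Lemma closed_subspace_null (q : nat -> bop E F -> R) (c : R) :
  0 <= c ->
  (forall n T, 0 <= q n T <= c * `|T|) ->
  (forall n a S T, q n (a *: S + T) <= `|a| * q n S + q n T) ->
  closed_subspace [set T | q n T @[n --> \oo] --> (0 : R)].
Proof.
move=> c0 qb qD.
have squeeze (u v : nat -> R) : (forall n, 0 <= u n <= v n) ->
    v @ \oo --> (0 : R) -> u @ \oo --> (0 : R).
  move=> uv v0; apply: (squeeze_cvgr _ (cvg_cst 0) v0).
  by apply: nearW => n; exact: uv.
have q0 n T : 0 <= q n T by case/andP: (qb n T).
split=> [|a S T qS qT|T qT] /=.
- apply: (squeeze _ (fun=> 0)); last exact: cvg_cst.
  by move=> n; have := qb n 0; rewrite normr0 mulr0.
- apply: (squeeze _ (fun n => `|a| * q n S + q n T)).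
    by move=> n; rewrite q0 qD.
  rewrite -[X in _ --> X](addr0 (0 : R)) -{1}(mulr0 `|a|).
  by apply: cvgD => //; apply: cvgMr.
- apply/cvgrPdist_le => e e0.
  have c1 : 0 < c + 1 by rewrite ltr_wpDl.
  have e2 : 0 < e / 2 by rewrite divr_gt0.
  have [S qS TS] := qT _ (divr_gt0 e2 c1).
  move/cvgrPdist_le : qS => /(_ _ e2); apply: filterS => n.
  rewrite !sub0r !normrN !ger0_norm// => qS.
  have := qD n 1 (T - S) S; rewrite scale1r subrK normr1 mul1r => /le_trans.
  apply; rewrite [leRHS]splitr lerD//.
  have /andP[_ /le_trans] := qb n (T - S); apply.
  rewrite (le_trans (ler_wpM2l c0 TS))// mulrCA ler_piMr ?(ltW e2)//.
  by rewrite ler_pdivrMr// mul1r lerDl.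
Qed.

Lemma closed_subspace_abs_null (y : nat -> bop E F -> R) (c : R) :
  0 <= c -> (forall n T, `|y n T| <= c * `|T|) ->
  (forall n a S T, y n (a *: S + T) = a * y n S + y n T) ->
  closed_subspace [set T | y n T @[n --> \oo] --> (0 : R)].
Proof.
move=> c0 yc yD.
have -> : [set T | y n T @[n --> \oo] --> (0 : R)] =
          [set T | `|y n T| @[n --> \oo] --> (0 : R)].
  apply/seteqP; split=> T /=; last exact: norm_cvg0.
  by move/cvg_norm; rewrite normr0.
apply: closed_subspace_null c0 _ _ => n; first by move=> T; rewrite normr_ge0 yc.
by move=> a S T; rewrite yD -normrM ler_normD.
Qed.

End closed_subspaces.

Section modulus_facts.
Context {R : realType} {E : banachLatticeType R}.
Implicit Types (x y : E) (g : dual E).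

Lemma modulus_linear_le a x y :
  modulus (a *: x + y) <=o `|a| *: modulus x + modulus y.
Proof.
have Nle z : - z <=o modulus z by exact: bl_le_joinr.
have [a0|a0] := leP 0 a.
  rewrite ?(ger0_norm a0); apply: bl_join_le.
    by apply: bl_leD; [apply: bl_leZ => //|]; exact: le_modulus.
  by rewrite opprD -scalerN; apply: bl_leD; [exact: bl_leZ|exact: Nle].
have Na0 : 0 <= - a by rewrite oppr_ge0 ltW.
rewrite ltr0_norm//; apply: bl_join_le.
  apply: bl_leD; last exact: le_modulus.
  by rewrite -[a *: x]opprK -scaleNr -scalerN; exact: bl_leZ.
rewrite opprD -scaleNr; apply: bl_leD; last exact: Nle.
by apply: bl_leZ => //; exact: le_modulus.
Qed.

Lemma dual_ge0_le g x y : 0 <=o g -> x <=o y -> g x <= g y.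
Proof.
move=> g0 xy; rewrite -subr_ge0 -linearB; apply: (g0 (y - x)).
exact/bl_subr_ge0.
Qed.

Lemma dual_modulus_ge0 g x : 0 <= modulus g (modulus x).
Proof. by apply: (modulus_ge0 g (modulus x)); exact: modulus_ge0. Qed.

Lemma dual_modulus_le g x : modulus g (modulus x) <= `|g| * `|x|.
Proof.
rewrite -(norm_modulus g) -(norm_modulus x) (le_trans (ler_norm _))//.
exact: (bop_normP (modulus g)).
Qed.

Lemma dual_le_modulus g x : `|g x| <= modulus g (modulus x).
Proof. exact: dual_abs. Qed.

(** For a fixed [g] the map [T |-> g (modulus (T x))] need not be
    subadditive unless [g] is positive; testing with the functionals
    [modulus g] suffices and gives seminorms. *)
Lemma w_null_modulusP (y : nat -> E) :
  w_null (fun n => modulus (y n)) <->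
  forall g : dual E, modulus g (modulus (y n)) @[n --> \oo] --> (0 : R).
Proof.
split=> y0 g; first exact: y0.
apply: norm_cvg0; apply: squeeze_cvgr (cvg_cst 0) (y0 g).
apply: nearW => n; rewrite normr_ge0 (le_trans (dual_le_modulus _ _))//.
by rewrite (ge0_modulus (modulus_ge0 (y n))).
Qed.

Lemma wstar_null_modulusP (f : nat -> dual E) :
  wstar_null (fun n => modulus (f n)) <->
  forall x : E, modulus (f n) (modulus x) @[n --> \oo] --> (0 : R).
Proof.
split=> f0 x; first exact: f0.
apply: norm_cvg0; apply: squeeze_cvgr (cvg_cst 0) (f0 x).
apply: nearW => n; rewrite normr_ge0 (le_trans (dual_le_modulus _ _))//.
by rewrite (ge0_modulus (modulus_ge0 (f n))).
Qed.

End modulus_facts.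

Section adjoint_facts.
Context {R : realType} {E F : banachLatticeType R}.
Implicit Types (S T : bop E F) (f : dual F).

Lemma adjoint_linear a S T f :
  adjoint (a *: S + T) f = a *: adjoint S f + adjoint T f.
Proof. by apply: bop_ext => x; exact: (linearP f a (S x) (T x)). Qed.

Lemma adjoint_norm T f : `|adjoint T f| <= `|f| * `|T|.
Proof.
apply: bop_norm_le => [|x]; first by rewrite mulr_ge0.
by rewrite -mulrA (le_trans (bop_normP f _))// ler_wpM2l// bop_normP.
Qed.

End adjoint_facts.

Section null_classes.
Context {R : realType} {E F : banachLatticeType R}.
Implicit Types (S T : bop E F).

Lemma closed_subspace_norm_adjoint (f : nat -> dual F) : wstar_null f ->
  closed_subspace [set T : bop E F | norm_null (fun n => adjoint T (f n))].
Proof.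
move=> /wstar_null_bounded[M M0 fM].
apply: (@closed_subspace_null _ _ _ _ M) => // n => [T|a S T].
  by rewrite normr_ge0 (le_trans (adjoint_norm _ _))// ler_wpM2r.
by rewrite adjoint_linear -normrZ ler_normD.
Qed.

Lemma closed_subspace_w_adjoint (f : nat -> dual F) : wstar_null f ->
  closed_subspace [set T : bop E F | w_null (fun n => adjoint T (f n))].
Proof.
move=> /wstar_null_bounded[M M0 fM]; apply: closed_subspace_forall => g.
apply: (@closed_subspace_abs_null _ _ _ _ (`|g| * M)) => [|n T|n a S T].
- by rewrite mulr_ge0.
- rewrite -mulrA (le_trans (bop_normP g _))// ler_wpM2l//.
  by rewrite (le_trans (adjoint_norm _ _))// ler_wpM2r.
- by rewrite adjoint_linear linearP.
Qed.

Lemma closed_subspace_wstar_modulus_adjoint (f : nat -> dual F) : wstar_null f ->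
  closed_subspace
    [set T : bop E F | wstar_null (fun n => modulus (adjoint T (f n)))].
Proof.
move=> /wstar_null_bounded[M M0 fM].
rewrite (_ : mkset _ = [set T | forall x : E,
    modulus (adjoint T (f n)) (modulus x) @[n --> \oo] --> (0 : R)]); last first.
  by apply/seteqP; split=> T /wstar_null_modulusP.
apply: closed_subspace_forall => x.
apply: (@closed_subspace_null _ _ _ _ (`|x| * M)) => [|n T|n a S T].
- by rewrite mulr_ge0.
- apply/andP; split; first exact: dual_modulus_ge0.
  rewrite (le_trans (dual_modulus_le _ _))// mulrC -mulrA ler_wpM2l//.
  by rewrite (le_trans (adjoint_norm _ _))// ler_wpM2r.
- rewrite adjoint_linear.
  have le : dual_le (modulus (a *: adjoint S (f n) + adjoint T (f n)))
      (`|a| *: modulus (adjoint S (f n)) + modulus (adjoint T (f n))).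
    exact: modulus_linear_le.
  exact: le (modulus_ge0 x).
Qed.

Lemma closed_subspace_norm_image (x : nat -> E) : w_null x ->
  closed_subspace [set T : bop E F | norm_null (fun n => T (x n))].
Proof.
move=> /w_null_bounded[M M0 xM].
apply: (@closed_subspace_null _ _ _ _ M) => // n => [T|a S T].
  by rewrite normr_ge0 (le_trans (bop_normP _ _))// mulrC ler_wpM2r.
by rewrite bopDE bopZE -normrZ ler_normD.
Qed.

Lemma closed_subspace_w_modulus_image (x : nat -> E) : w_null x ->
  closed_subspace [set T : bop E F | w_null (fun n => modulus (T (x n)))].
Proof.
move=> /w_null_bounded[M M0 xM].
rewrite (_ : mkset _ = [set T : bop E F | forall g : dual F,
    modulus g (modulus (T (x n))) @[n --> \oo] --> (0 : R)]); last first.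
  by apply/seteqP; split=> T /w_null_modulusP.
apply: closed_subspace_forall => g.
apply: (@closed_subspace_null _ _ _ _ (`|g| * M)) => [|n T|n a S T].
- by rewrite mulr_ge0.
- apply/andP; split; first exact: dual_modulus_ge0.
  rewrite (le_trans (dual_modulus_le _ _))// -mulrA ler_wpM2l//.
  by rewrite (le_trans (bop_normP _ _))// mulrC ler_wpM2r.
- rewrite -linearP; apply: dual_ge0_le; first exact: modulus_ge0.
  exact: modulus_linear_le.
Qed.

Lemma closed_subspace_pairing (f : nat -> dual F) (x : nat -> E) :
  wstar_null f -> w_null x ->
  closed_subspace [set T : bop E F | f n (T (x n)) @[n --> \oo] --> (0 : R)].
Proof.
move=> /wstar_null_bounded[M M0 fM] /w_null_bounded[K K0 xK].
apply: (@closed_subspace_abs_null _ _ _ _ (M * K)) => [|n T|n a S T].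
- by rewrite mulr_ge0.
- rewrite (le_trans (bop_normP _ _))// -mulrA ler_pM//.
  by rewrite (le_trans (bop_normP _ _))// mulrC ler_wpM2r.
- by rewrite bopDE bopZE linearP.
Qed.

End null_classes.

(** * Classes defined by compactness *)

Section ultrafilters.

Lemma ultra_fmap (S T : Type) (f : S -> T) (V : set_system S) :
  UltraFilter V -> UltraFilter (f @ V).
Proof.
move=> UV; split=> [|G GG VG]; first exact: fmap_proper_filter.
apply/seteqP; split=> [A GA|]; last exact: VG.
have [VA|VNA] := in_ultra_setVsetC (f @^-1` A) UV.
  exact: VA.
have GAN : G (A `&` ~` A) by apply: filterI; [exact: GA|exact: VG].
by have [x []] := filter_ex GAN.
Qed.

(** An ultrafilter on the closure of [A] need not contain [A]. It is compared with
    an ultrafilter [G] containing [A] and all the open members of [V]; a limit of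
    [G] is also a limit of [V], because every point has a base of closed
    neighbourhoods. *)
Lemma regular_precompact (T : topologicalType) (A : set T) :
  regular_space T ->
  (forall V : set_system T, UltraFilter V -> V A -> exists p : T, V --> p) ->
  precompact A.
Proof.
move=> regT Acvg; rewrite precompactE compact_ultra => V UV VA.
pose B : set_system T := [set U | exists W, [/\ open W, V W & A `&` W `<=` U]].
have BF : ProperFilter B.
  apply: Build_ProperFilter_ex.
    move=> U [W [oW VW WU]].
    have [x [clx Wx]] := filter_ex (filterI VA VW).
    have [y [Ay Wy]] := clx W (open_nbhs_nbhs (conj oW Wx)).
    by exists y; exact: WU.
  split.
  - by exists setT; split => //; [exact: openT|exact: filterT].
  - move=> U U' [W [oW VW WU]] [W1 [oW1 VW1 WU']]; exists (W `&` W1).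
    split; [exact: openI|exact: filterI|].
    by move=> x [Ax [Wx Wx1]]; split; [exact: WU|exact: WU'].
  - move=> U U' UU' [W [oW VW WU]]; exists W; split=> //.
    exact: subset_trans UU'.
have [G [UG BG]] := ultraFilterLemma BF.
have GA : G A.
  by apply: BG; exists setT; split => [| |x []//]; [exact: openT|exact: filterT].
have [p Gp] := Acvg G UG GA; exists p; split.
  by move=> U pU; apply: (@filter_ex _ G); apply: filterI; [exact: GA|exact: Gp].
move=> U /regT[C pC CU]; apply: filterS CU _.
have [//|VNC] := in_ultra_setVsetC (closure C) UV.
have GNC : G (~` closure C).
  apply: BG; exists (~` closure C); split; last by move=> x [].
    exact/closed_openC/closed_closure.
  exact: VNC.
have GC : G C by exact: Gp.
have [x [Cx []]] := filter_ex (filterI GC GNC).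
exact: subset_closure.
Qed.

(** Working with ultrafilters on the source rather than on the image lets two
    operators be compared along one and the same ultrafilter. *)
Lemma precompact_imageP (S : Type) (T : topologicalType) (f : S -> T)
    (A : set S) : regular_space T ->
  precompact (f @` A) <->
  (forall V : set_system S, UltraFilter V -> V A -> exists p : T, f @ V --> p).
Proof.
move=> regT; split=> [fAc V UV VA|Acvg].
  have VfA : V (f @^-1` closure (f @` A)).
    by apply: filterS VA => x Ax; apply: subset_closure; exists x.
  move: fAc; rewrite precompactE compact_ultra.
  by move=> /(_ _ (ultra_fmap f UV) VfA)[p [_ fp]]; exists p.
apply: regular_precompact => // V UV VfA.
have [y0 [s0 _ _]] := filter_ex VfA.
have /choice[g gP] y : exists x, (f @` A) y -> A x /\ f x = y.
  have [[x Ax xy]|n] := pselect ((f @` A) y); first by exists x.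
  by exists s0.
have VgA : V (g @^-1` A) by apply: filterS VfA => y /gP[].
have [p Vp] := Acvg _ (ultra_fmap g UV) VgA.
exists p => U /Vp VU; have : V ((f \o g) @^-1` U `&` f @` A) by apply: filterI.
by apply: filterS => y [/= + /gP[_ <-]].
Qed.

End ultrafilters.

Lemma weak_cvgP {R : realType} (X : normedModType R) (V : set_system X) (p : X) :
  Filter V -> ((V : set_system (weak X)) --> (p : weak X)) <->
  (forall f : dual X, f @ V --> f p).
Proof.
move=> FV; split=> [Vp f|Vp].
  pose ev (y : weak X) : {ptws (dual X) -> R} := fun f => f y.
  have wf : continuous (@proj (dual X) (fun=> R) f \o ev : weak X -> R).
    move=> y; apply: (@continuous_comp (weak X) {ptws (dual X) -> R} R).
      exact: initial_continuous.
    exact: (@proj_continuous (dual X) (fun=> R) f).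
  exact: (cvg_comp _ _ Vp (wf p)).
by apply: cvg_initial; apply/cvg_sup => f; apply: cvg_initial; exact: Vp.
Qed.

Lemma weak_regular {R : realType} (X : normedModType R) : regular_space (weak X).
Proof.
exact: (@uniform_regular
  (initial_topology ((fun x f => f x) : X -> {ptws (dual X) -> R}))).
Qed.

Section compact_classes.
Context {R : realType} {E F : banachLatticeType R}.
Implicit Types (S T : bop E F) (A : set E).

Lemma bounded_set_norm_le A : bounded_set A ->
  exists2 M : R, 0 < M & forall x, A x -> `|x| <= M.
Proof.
move=> [M [_ AM]]; exists (`|M| + 1); first by rewrite ltr_wpDl.
by apply: AM; rewrite ltr_pwDr// ler_norm.
Qed.

(** Along an ultrafilter containing the bounded set [A], sums of convergent images
    converge, and the image under a norm limit is Cauchy. *)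
Lemma closed_subspace_precompact A : bounded_set A ->
  closed_subspace [set T : bop E F | precompact (T @` A)].
Proof.
move=> /bounded_set_norm_le[M M0 AM].
rewrite (_ : mkset _ = [set T : bop E F | forall V : set_system E,
    UltraFilter V -> V A -> exists p : F, T @ V --> p]); last first.
  apply/seteqP; split=> T.
    by move/precompact_imageP; apply; exact: uniform_regular.
  by move=> ?; apply/precompact_imageP => //; exact: uniform_regular.
apply: closed_subspace_forall => V; apply: closed_subspace_forall => UV.
apply: closed_subspace_forall => VA.
split=> [|a S T [p Sp] [q Tq]|T TV] /=.
- by exists 0; exact: cvg_cst.
- by exists (a *: p + q); apply: cvgD => //; exact: cvgZr.
- suff : cvg (T @ V) by move=> /cvg_ex.
  apply: cauchy_cvg; apply: cauchy_exP => e e0.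
  have e2 : 0 < e / 2 by rewrite divr_gt0.
  have [S [p Sp] TS] := TV _ (divr_gt0 e2 M0); exists p.
  have /cvgrPdist_lt/(_ _ e2) Spe := Sp.
  apply: filterS (filterI Spe VA) => x [/= pSx /AM xM].
  rewrite -ball_normE /ball_/= -(subrKA (S x)) (le_lt_trans (ler_normD _ _))//.
  rewrite [ltRHS]splitr ltr_leD// distrC -[T x - S x]/((T - S) x).
  rewrite (le_trans (bop_normP _ _))// (le_trans (ler_pM _ _ TS xM))//.
  by rewrite divfK ?gt_eqF.
Qed.

(** Grothendieck's argument. If [T] is a norm limit of operators [S] whose images
    converge weakly along [V], to points [p] say, then the functional
    [f |-> lim f (T x)] is within [|T - S|] (up to the bound of [A]) of
    evaluation at [p]. By norming functionals the points [p] form a Cauchy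
    family for the norm, and its limit is the weak limit of the image of [T]. *)
Lemma closed_subspace_weakly_precompact A : bounded_set A ->
  closed_subspace [set T : bop E F | relatively_weakly_compact (T @` A)].
Proof.
move=> /bounded_set_norm_le[M M0 AM].
rewrite (_ : mkset _ = [set T : bop E F | forall V : set_system E,
    UltraFilter V -> V A ->
    exists p : F, forall f : dual F, (f \o T) @ V --> f p]); last first.
  apply/seteqP; split=> T.
    move=> /(precompact_imageP (T : E -> weak F) A (@weak_regular _ F)) + V UV VA.
    by move=> /(_ V UV VA)[p /weak_cvgP Tp]; exists p.
  move=> TV; apply/(precompact_imageP (T : E -> weak F) A (@weak_regular _ F)).
  by move=> V UV /(TV V UV)[p Tp]; exists p; exact/weak_cvgP.
apply: closed_subspace_forall => V; apply: closed_subspace_forall => UV.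
apply: closed_subspace_forall => VA.
split=> [|a S T [p Sp] [q Tq]|T TV] /=.
- exists 0 => f; rewrite linear0; apply: cvg_near_cst.
  by apply: nearW => x /=; rewrite linear0.
- exists (a *: p + q) => f; rewrite linearP.
  rewrite (_ : _ \o _ = (fun x => a *: (f \o S) x + (f \o T) x)).
    by apply: cvgD; [apply: cvgZr; exact: Sp|exact: Tq].
  by apply/funext => x; exact: (linearP f a (S x) (T x)).
(* L e gathers the weak limits along V of the images of the operators of the class
   that are e-close to T on A. *)
pose L (e : R) : set F := [set p | exists2 S, `|T - S| <= e / M &
  forall f : dual F, (f \o S) @ V --> f p].
have L_dist (f : dual F) e S x : `|T - S| <= e / M -> A x ->
    `|f (T x) - f (S x)| <= `|f| * e.
  move=> TS /AM xM; rewrite -linearB (le_trans (bop_normP _ _))// ler_wpM2l//.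
  rewrite -[T x - S x]/((T - S) x) (le_trans (bop_normP _ _))//.
  by rewrite (le_trans (ler_pM _ _ TS xM))// divfK ?gt_eqF.
have L_cvg (f : dual F) e p (d : R) : L e p -> 0 < d ->
    V [set x | `|f (T x) - f p| <= `|f| * e + d].
  move=> [S TS Sp] d0; have /cvgrPdist_le/(_ _ d0) Spd := Sp f.
  apply: filterS (filterI Spd VA) => x [/= pSx Ax].
  rewrite -(subrKA (f (S x))) (le_trans (ler_normD _ _))// lerD ?L_dist//.
  by rewrite distrC.
have L_diam e p q : 0 < e -> L e p -> L e q -> `|p - q| <= e + e.
  move=> e0 Lp Lq; apply: dual_norm_le => [|f]; first by rewrite addr_ge0// ltW.
  apply/ler_addgt0Pr => d d0; have d2 : 0 < d / 2 by rewrite divr_gt0.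
  have [x [xp xq]] :=
    filter_ex (filterI (L_cvg f _ _ _ Lp d2) (L_cvg f _ _ _ Lq d2)).
  rewrite linearB -(subrKA (f (T x))) (le_trans (ler_normD _ _))// distrC.
  by rewrite (le_trans (lerD xp xq))// addrACA -splitr -mulrDr mulrC.
have L_ex e : 0 < e -> L e !=set0.
  move=> e0; have [S [p Sp] TS] := TV _ (divr_gt0 e0 M0).
  by exists p, S.
have L_le e d : e <= d -> L e `<=` L d.
  move=> ed p [S TS Sp]; exists S => //; rewrite (le_trans TS)//.
  by rewrite ler_pM2r// invr_gt0.
pose G : set_system F := filter_from [set e : R | 0 < e] L.
have GG : ProperFilter G.
  apply: filter_from_proper => [|e]; last exact: L_ex.
  apply: filter_from_filter; first by exists 1; exact: ltr01.
  move=> e d e0 d0; exists (Num.min e d) => [|p Lp].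
    by rewrite /= lt_min e0.
  by split; apply: L_le Lp; rewrite ge_min lexx ?orbT.
have [p Gp] : exists p : F, G --> p.
  apply/cvg_ex; apply: cauchy_cvg; apply: cauchy_exP => e e0.
  have e3 : 0 < e / 3 by rewrite divr_gt0.
  have [p Lp] := L_ex _ e3; exists p, (e / 3) => //= q Lq.
  rewrite -ball_normE /ball_/= (le_lt_trans (L_diam _ _ _ e3 Lp Lq))//.
  by lra.
exists p => f; apply/cvgrPdist_le => e e0.
have f1 : 0 < `|f| + 1 by rewrite ltr_wpDl.
pose d := e / 3 / (`|f| + 1).
have d0 : 0 < d by rewrite !divr_gt0.
have fd : `|f| * d <= e / 3.
  rewrite mulrCA ler_piMr ?divr_ge0 ?(ltW e0)//.
  by rewrite ler_pdivrMr// mul1r lerDl.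
have [q [Lq pq]] : (L d `&` [set q | `|p - q| <= d]) !=set0.
  apply: (@filter_ex _ G); apply: filterI; first by exists d.
  apply: Gp; apply/nbhs_ballP; exists d => //= q.
  by rewrite -ball_normE => /ltW.
have e3 : 0 < e / 3 by rewrite divr_gt0.
apply: filterS (L_cvg f _ _ _ Lq e3) => x /= qTx.
rewrite -(subrKA (f q)) (le_trans (ler_normD _ _))// -linearB [X in _ + X]distrC.
have := le_trans (bop_normP f _) (ler_wpM2l (normr_ge0 f) pq).
by lra.
Qed.

End compact_classes.

(** * The fourteen classes *)

Theorem theorem2p3p2 (R : realType) (E F : banachLatticeType R) :
  banach_under (regularly (PSP E F)) (enveloping_norm (PSP E F)) /\
  banach_under (regularly (DPSP E F)) (enveloping_norm (DPSP E F)) /\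
  banach_under (regularly (DDSP E F)) (enveloping_norm (DDSP E F)) /\
  banach_under (regularly (PGP E F)) (enveloping_norm (PGP E F)) /\
  banach_under (regularly (DGP E F)) (enveloping_norm (DGP E F)) /\
  banach_under (regularly (swl E F)) (enveloping_norm (swl E F)) /\
  banach_under (regularly (dswl E F)) (enveloping_norm (dswl E F)) /\
  banach_under (regularly (swstarl E F)) (enveloping_norm (swstarl E F)) /\
  banach_under (regularly (d_op E F)) (enveloping_norm (d_op E F)) /\
  banach_under (regularly (bi_sP E F)) (enveloping_norm (bi_sP E F)) /\
  banach_under (regularly (GPP E F)) (enveloping_norm (GPP E F)) /\
  banach_under (regularly (s_GPP E F)) (enveloping_norm (s_GPP E F)) /\
  banach_under (regularly (BDP E F)) (enveloping_norm (BDP E F)) /\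
  banach_under (regularly (s_BDP E F)) (enveloping_norm (s_BDP E F)).
Proof.
do 13?[apply: conj]; apply: regularly_banach.
- do 3!apply: closed_subspace_forall => ?; exact: closed_subspace_norm_image.
- do 3!apply: closed_subspace_forall => ?; exact: closed_subspace_norm_adjoint.
- do 3!apply: closed_subspace_forall => ?; exact: closed_subspace_norm_adjoint.
- do 3!apply: closed_subspace_forall => ?; exact: closed_subspace_w_adjoint.
- do 3!apply: closed_subspace_forall => ?; exact: closed_subspace_w_adjoint.
- do 2!apply: closed_subspace_forall => ?.
  exact: closed_subspace_w_modulus_image.
- do 3!apply: closed_subspace_forall => ?.
  exact: closed_subspace_w_modulus_image.
- do 2!apply: closed_subspace_forall => ?.
  exact: closed_subspace_wstar_modulus_adjoint.
- do 3!apply: closed_subspace_forall => ?.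
  exact: closed_subspace_wstar_modulus_adjoint.
- do 6!apply: closed_subspace_forall => ?; exact: closed_subspace_pairing.
- apply: closed_subspace_forall => A; apply: closed_subspace_forall => -[bA _].
  exact: closed_subspace_precompact.
- apply: closed_subspace_forall => A; apply: closed_subspace_forall => -[bA _].
  exact: closed_subspace_precompact.
- apply: closed_subspace_forall => A; apply: closed_subspace_forall => -[bA _].
  exact: closed_subspace_weakly_precompact.
- apply: closed_subspace_forall => A; apply: closed_subspace_forall => -[bA _].
  exact: closed_subspace_weakly_precompact.
Qed.
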